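(* Let $\Phi\in\Xi^k_{\mathrm B}(\mathcal X,\mathbb R)$, $k\ge2$, $\mathcal X\subset\mathbb R^n$ open, be an MLP with a bottleneck, with weight matrices $W=(W_1,\widetilde W_1,\ldots,W_L,\widetilde W_L)=(V_1,\ldots,V_{2L})\in\mathbb W$. Assume that $\Phi$ has its first bottleneck in layer $j^*$ (of width $d_{j^*}$). Define for $l\in\{1,\ldots,2L-1\}$ the matrix product $$Z_l(x)=\widetilde W_L\Psi_L(a_L)W_L\cdots V_{l+1}\in\mathbb R^{1\times d_l},$$ where $V_{l+1}=W_{l/2+1}$ if $l$ is even and $V_{l+1}=\widetilde W_{(l+1)/2}$ if $l$ is odd; i.e. $Z_l(x)$ is the product of all matrices occurring in the gradient $\nabla\Phi(x)^\top=\widetilde W_L\Psi_L(a_L)W_L\cdots\widetilde W_1\Psi_1(a_1)W_1$ until $V_{l+1}$. (a) Let the first bottleneck of $\Phi$ be non-augmented, i.e. $n=d_0\ge\ldots>d_{j^*}$, and let $Z_{j^*}(x)\ne0$ for all $x\in\mathcal X$. If $W\in\mathbb W^*$, $\Phi$ is of class $(\mathcal C1)^k(\mathcal X,\mathbb R)$. Consequently, for all sets of weights $(\operatorname{vecm}(W);\operatorname{stk}(b))\in\mathbb R^{N_W+N_B}$, $W\in\mathbb W$, $b\in\mathbb B$, except possibly for a zero set in $\mathbb R^{N_W+N_B}$ with respect to the Lebesgue measure, $\Phi$ is of class $(\mathcal C1)^k(\mathcal X,\mathbb R)$. (b) Let the first bottleneck of $\Phi$ be non-augmented, i.e. $n=d_0\ge\ldots>d_{j^*}$,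 and denote the set of points $x\in\mathcal X$ such that $Z_{j^*}(x)=0$ by $\mathcal X^*\neq\varnothing$. Then every critical point $x^*\in\mathcal X^*$ is degenerate, such that $\Phi$ is of class $(\mathcal C3)^k(\mathcal X,\mathbb R)$. (c) Let the first bottleneck of $\Phi$ be augmented, i.e. there exists an index $i^*<j^*$ with $n=d_0\le\ldots<d_{i^*}$, and let $Z_{i^*}(x)\ne0$ for all $x\in\mathcal X$. Then $\Phi$ is for all weights $(\operatorname{vecm}(W);\operatorname{stk}(b))\in\mathbb R^{N_W+N_B}$, $W\in\mathbb W^*$, $b\in\mathbb B$, except possibly for a zero set in $\mathbb R^{N_W+N_B}$ with respect to the Lebesgue measure, of class $(\mathcal C1)^k(\mathcal X,\mathbb R)$ or $(\mathcal C2)^k(\mathcal X,\mathbb R)$. The same statement holds if $\mathbb W^*$ is replaced by $\mathbb W$. (d) Let the first bottleneck of $\Phi$ be augmented, i.e. there exists an index $i^*<j^*$ with $n=d_0\le\ldots<d_{i^*}$, and denote the set of points $x\in\mathcal X$ such that $Z_{i^*}(x)=0$ by $\mathcal X^*\neq\varnothing$. Then $x^*\in\mathcal X^*$ can be either degenerate or non-degenerate, so $\Phi$ is of class $(\mathcal C2)^k(\mathcal X,\mathbb R)$ or $(\mathcal C3)^k(\mathcal X,\mathbb R)$.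
   Context: MLP setting. An MLP with $L\ge1$ on an open set $\mathcal X\subset\mathbb R^n$ is given by $h_0=x\in\mathcal X$ and, for $l=1,\ldots,L$, $h_l=\widetilde W_l\,\sigma_l(a_l)+\tilde b_l$ with $a_l=W_lh_{l-1}+b_l$, where $W_l\in\mathbb R^{m_l\times n_{l-1}}$, $\widetilde W_l\in\mathbb R^{n_l\times m_l}$ are weight matrices, $b_l\in\mathbb R^{m_l}$, $\tilde b_l\in\mathbb R^{n_l}$ are biases, $n_0=n$, $n_L=1$, and $\sigma_l$ is applied component-wise with components $[\sigma_l]_i:\mathbb R\to\mathbb R$. The network map is $\Phi(x)=h_L\in\mathbb R$. $\Xi^k(\mathcal X,\mathbb R)$ is the set of all such MLPs with $[\sigma_l]_i$ strictly monotone and of class $C^k$ (strict monotonicity of a differentiable component means: its derivative is everywhere $>0$ or everywhere $<0$). The layers are jointly enumerated by $0,1,\ldots,2L$ with widths $d_{2l}=n_l$, $d_{2l-1}=m_l$, and the weight matrices by $V_{2l-1}=W_l$, $V_{2l}=\widetilde W_l$, so $V_j\in\mathbb R^{d_j\times d_{j-1}}$. $\Psi_l(a_l)=\operatorname{diag}([\sigma_l]_i'([a_l]_i))\in\mathbb R^{m_l\times m_l}$. The MLP has a bottleneck in layer $j$ if there are layers $i<j<l$ (in $\{0,\ldots,2L\}$) with $d_i>d_j$ and $d_j<d_l$; the first bottleneck is the one with smallest index $j$. $\Xi^k_{\mathrm B}(\mathcal X,\mathbb R)$ is the set of MLPs in $\Xi^k(\mathcal X,\mathbb R)$ with a bottleneck.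 The notation $n=d_0\ge\ldots>d_{j^*}$ means the widths are monotonically decreasing from layer $0$ to layer $j^*$ with strict decrease in the last step; $n=d_0\le\ldots<d_{i^*}$ means they are monotonically increasing from layer $0$ to layer $i^*$ with strict increase in the last step. $\mathbb W=\prod_{j=1}^{2L}\mathbb R^{d_j\times d_{j-1}}$ is the weight space; $\mathbb W^*\subset\mathbb W$ is the set of tuples with $\operatorname{rank}(V_j)=\min\{d_j,d_{j-1}\}$ for all $j$; $\mathbb B=\prod_{j=1}^{2L}\mathbb R^{d_j}$ is the space of biases $b=(b_1,\tilde b_1,\ldots,b_L,\tilde b_L)$. $\operatorname{vecm}:\mathbb W\to\mathbb R^{N_W}$, $N_W=\sum_{j=1}^{2L} d_jd_{j-1}$, and $\operatorname{stk}:\mathbb B\to\mathbb R^{N_B}$, $N_B=\sum_{j=1}^{2L}d_j$, are the bijections stacking all entries into one vector. A critical point is a zero of $\nabla\Phi$; it is degenerate if the Hessian there is singular and non-degenerate otherwise. $(\mathcal C1)^k(\mathcal X,\mathbb R)$: $C^k$ functions with no critical point. $(\mathcal C2)^k(\mathcal X,\mathbb R)$: $C^k$ functions with at least one critical point, all critical points being non-degenerate. $(\mathcal C3)^k(\mathcal X,\mathbb R)$: $C^k$ functions with at least one degenerate critical point. *)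

(* Defs.v *)
From HB Require Import structures.
From mathcomp Require Import all_boot all_order all_algebra.
From mathcomp Require Import all_classical all_reals all_analysis.
Set Implicit Arguments.
Unset Strict Implicit.
Unset Printing Implicit Defensive.
Import Order.TTheory GRing.Theory Num.Theory.
Import numFieldNormedType.Exports.
Local Open Scope classical_set_scope.
Local Open Scope ring_scope.

Section Smoothness.
Variables (R : realType) (n : nat).
Implicit Types (X : set 'cV[R]_n) (f : 'cV[R]_n -> R) (x : 'cV[R]_n).

Definition basis_vec (i : 'I_n) : 'cV[R]_n := delta_mx i 0.

(* All iterated partial derivatives of order <= k exist and are continuous at
   the points of X.  The functions are total; for X open this only depends on
   their restriction to X. *)
Fixpoint Ck (k : nat) X f : Prop :=
  (forall x, X x -> {for x, continuous f}) /\
  if k is k'.+1 then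
    forall i : 'I_n, (forall x, X x -> derivable f x (basis_vec i)) /\
                     Ck k' X ('D_(basis_vec i) f)
  else True.

Definition gradient f x : 'cV[R]_n := \col_i 'D_(basis_vec i) f x.

Definition hessian f x : 'M[R]_n :=
  \matrix_(i, j) 'D_(basis_vec j) ('D_(basis_vec i) f) x.

Definition critical f x : Prop := gradient f x = 0.

Definition degenerate f x : Prop := hessian f x \notin unitmx.

Definition classC1 k X f : Prop :=
  Ck k X f /\ forall x, X x -> ~ critical f x.

Definition classC2 k X f : Prop :=
  [/\ Ck k X f,
      exists x, X x /\ critical f x &
      forall x, X x -> critical f x -> ~ degenerate f x].

Definition classC3 k X f : Prop :=
  Ck k X f /\ exists x, [/\ X x, critical f x & degenerate f x].

End Smoothness.

(* Lebesgue null sets of R^N: for every e > 0 there is a countable cover by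
   closed boxes of total volume <= e (the set need not be measurable). *)
Definition lebesgue_null (R : realType) (N : nat) (E : set 'cV[R]_N) : Prop :=
  forall e : R, 0 < e ->
  exists lo hi : nat -> 'cV[R]_N,
  [/\ forall m i, lo m i 0 <= hi m i 0,
      E `<=` \bigcup_m [set p | forall i, lo m i 0 <= p i 0 <= hi m i 0] &
      (\sum_(0 <= m <oo) (\prod_(i < N) (hi m i 0 - lo m i 0))%:E <= e%:E)%E].

(* Only the widths of the layers 0, ..., 2L are meaningful. *)
Record arch (n : nat) := Arch {
  depth : nat;
  width : nat -> nat;
  depth_gt0 : (0 < depth)%N;
  width_gt0 : forall j, (j <= depth.*2)%N -> (0 < width j)%N;
  width_in : width 0 = n;
  width_out : width depth.*2 = 1%N
}.

Section Architecture.
Variables (n : nat) (A : arch n).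
Local Notation d := (width A).
Local Notation L := (depth A).

Definition bottleneck (j : nat) : Prop :=
  exists i l, [/\ (i < j)%N, (j < l)%N, (l <= L.*2)%N, (d j < d i)%N &
                  (d j < d l)%N].

Definition first_bottleneck (j : nat) : Prop :=
  bottleneck j /\ forall j', (j' < j)%N -> ~ bottleneck j'.

(* d_0 >= d_1 >= ... >= d_(j-1) > d_j *)
Definition decreasing_to (j : nat) : Prop :=
  [/\ (0 < j)%N, forall i, (i < j)%N -> (d i.+1 <= d i)%N &
      (d j < d j.-1)%N].

(* d_0 <= d_1 <= ... <= d_(i-1) < d_i *)
Definition increasing_to (i : nat) : Prop :=
  [/\ (0 < i)%N, forall l, (l < i)%N -> (d l <= d l.+1)%N &
      (d i.-1 < d i)%N].

End Architecture.

Section Network.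
Variables (R : realType) (n : nat) (A : arch n).
Local Notation d := (width A).
Local Notation L := (depth A).

(* The matrix at index j : 'I_(2L) is V_(j+1), mapping layer j to layer j+1;
   hence W_(l+1) has index 2l and \tilde W_(l+1) has index 2l+1.  The biases
   (b_1, \tilde b_1, ..., b_L, \tilde b_L) are indexed in the same way. *)
Definition weights := forall j : 'I_L.*2, 'M[R]_(d j.+1, d j).
Definition biases := forall j : 'I_L.*2, 'cV[R]_(d j.+1).

(* The component [sigma_l]_i is act (2l-1) i, where l = 1, ..., L; the other
   indices j are never used. *)
Definition activations := forall j : nat, 'I_(d j) -> R -> R.

Definition strictly_monotone (f : R -> R) : Prop :=
  (forall y, 0 < (f^`())%classic y) \/ (forall y, (f^`())%classic y < 0).

Definition Ck_real (k : nat) (f : R -> R) : Prop :=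
  (forall i y, (i < k)%N -> derivable (f^`(i))%classic y 1) /\ continuous (f^`(k))%classic.

(* With widths and activations given, the weights and biases are unrestricted,
   so membership in Xi^k only constrains the activations. *)
Definition Xi (k : nat) (s : activations) : Prop :=
  forall l (i : 'I_(d l.*2.+1)), (l < L)%N ->
    strictly_monotone (s l.*2.+1 i) /\ Ck_real k (s l.*2.+1 i).

Definition full_rank (W : weights) : Prop :=
  forall j, \rank (W j) = minn (d j.+1) (d j).

Definition NW : nat := (\sum_(j < L.*2) d j.+1 * d j)%N.
Definition NB : nat := (\sum_(j < L.*2) d j.+1)%N.

Definition vecm (W : weights) : 'cV[R]_NW := \mxcol_(j < L.*2) (mxvec (W j))^T.
Definition stk (b : biases) : 'cV[R]_NB := \mxcol_(j < L.*2) b j.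

Definition parameters (W : weights) (b : biases) : 'cV[R]_(NW + NB) :=
  col_mx (vecm W) (stk b).

(* Extension by 0 of the families to all j : nat, to allow recursion on j. *)
Definition wt (W : weights) (j : nat) : 'M[R]_(d j.+1, d j) :=
  if @idP (j < L.*2)%N is ReflectT h then W (Ordinal h) else 0.
Definition bs (b : biases) (j : nat) : 'cV[R]_(d j.+1) :=
  if @idP (j < L.*2)%N is ReflectT h then b (Ordinal h) else 0.

Lemma wtE (W : weights) (j : 'I_L.*2) : wt W j = W j.
Proof.
case: j => j hj; rewrite /wt /=; case: {-}_ / idP => [h|]; last by rewrite hj.
by rewrite (bool_irrelevance h hj).
Qed.

Lemma bsE (b : biases) (j : 'I_L.*2) : bs b j = b j.
Proof.
case: j => j hj; rewrite /bs /=; case: {-}_ / idP => [h|]; last by rewrite hj.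
by rewrite (bool_irrelevance h hj).
Qed.

Variables (s : activations) (W : weights) (b : biases).
Arguments s : clear implicits.

Definition activate (j : nat) (v : 'cV[R]_(d j)) : 'cV[R]_(d j) :=
  if odd j then \col_i s j i (v i 0) else v.

(* layer x (2l) is h_l and layer x (2l-1) is the pre-activation a_l, see
   preactivationE and hiddenE below. *)
Fixpoint layer (x : 'cV[R]_n) (j : nat) : 'cV[R]_(d j) :=
  if j is j'.+1 then wt W j' *m activate (layer x j') + bs b j'
  else castmx (esym (width_in A), erefl) x.

Lemma preactivationE x l :
  layer x l.*2.+1 = wt W l.*2 *m layer x l.*2 + bs b l.*2.
Proof. by rewrite /= /activate odd_double. Qed.

Lemma hiddenE x l :
  layer x l.+1.*2 =
  wt W l.*2.+1 *m (\col_i s l.*2.+1 i (layer x l.*2.+1 i 0)) + bs b l.*2.+1.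
Proof.
rewrite -[LHS]/(wt W l.*2.+1 *m activate (layer x l.*2.+1) + bs b l.*2.+1).
by rewrite /activate [odd _]/= odd_double.
Qed.

Definition mlp (x : 'cV[R]_n) : R :=
  layer x L.*2 (cast_ord (esym (width_out A)) ord0) 0.

(* Psi x (2l-1) is the matrix Psi_l(a_l); no activation acts on even layers. *)
Definition Psi (x : 'cV[R]_n) (j : nat) : 'M[R]_(d j) :=
  if odd j then diag_mx (\row_i (s j i)^`()%classic (layer x j i 0)) else 1%:M.

(* In Z the base case const_mx 1 is reached in layer 2L, where the width is 1
   and it is the 1 x 1 identity matrix. *)
Fixpoint Zrec (x : 'cV[R]_n) (r j : nat) : 'rV[R]_(d j) :=
  if r is r'.+1 then Zrec x r' j.+1 *m Psi x j.+1 *m wt W j else const_mx 1.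

(* Z_l = V_(2L) Psi_(2L-1) V_(2L-1) ... Psi_(l+1) V_(l+1), jointly enumerated *)
Definition Z (x : 'cV[R]_n) (l : nat) : 'rV[R]_(d l) := Zrec x (L.*2 - l) l.

Lemma ZE x l : (l < L.*2)%N -> Z x l = Z x l.+1 *m Psi x l.+1 *m wt W l.
Proof. by move=> hl; rewrite /Z -(subnSK hl). Qed.

End Network.

(* Main.v *)
Require Import Defs.
From HB Require Import structures.
From mathcomp Require Import all_boot all_order all_algebra.
From mathcomp Require Import all_classical all_reals all_analysis.
From mathcomp Require Import ring lra zify.
Set Implicit Arguments.
Unset Strict Implicit.
Unset Printing Implicit Defensive.
Import Order.TTheory GRing.Theory Num.Theory.
Import numFieldNormedType.Exports.
Local Open Scope classical_set_scope.
Local Open Scope ring_scope.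

(* Write the gradient of the network as the product Z_j Psi_j J_j, where J_j is
   the Jacobian of layer j with respect to the input.  In the non-augmented case
   J_(j^* ) has full row rank for weights of full rank, so the gradient vanishes
   only with Z_(j^* ); where Z_(j^* ) vanishes the Hessian factors through a space
   of dimension d_(j^* ) < n.

   In the augmented case put m = i^* - 1.  Perturbing V_(m+1) by D and the
   corresponding bias by - D u, u being the activated value of layer m at x,
   leaves every layer at x unchanged and adds Z_(m+1) Psi_(m+1) D Psi_m J_m to the
   gradient.  As J_m has full column rank, the gradient is a submersion in the
   parameters wherever Z_(m+1) is nonzero.  Parametric transversality then bounds
   the parameters admitting a degenerate critical point: trading n parameters
   for the input x, the critical points become a Lipschitz graph over R^N, and
   at a degenerate critical point the graph moves, to first order, only inside a
   hyperplane.  Covering a grid of small cubes by the resulting thin slabs shows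
   that the set of these parameters is null.  The weights that are not of full
   rank are null by the same transversality statement, applied to the equations
   w V = 0. *)

(** * Functions of class C^k *)

Section Regularity.
Variable R : realType.

Section Lines.
Variable V : normedModType R.
Implicit Types (f : V -> R) (x v : V).

(** Reduces a derivative in direction [v] to that of a function of one real variable, for which the
    chain rule and the mean value theorem are at hand. *)
Lemma line_quotient f x v (t : R) :
  (fun h : R => h^-1 *: (((fun u : R => f (u *: v + x)) \o shift t) (h *: 1)
                         - f (t *: v + x))) =
  (fun h : R => h^-1 *: ((f \o shift (t *: v + x)) (h *: v)
                         - f (t *: v + x))).
Proof.
by apply/funext => h /=; rewrite -[h *: 1]/(h * 1) mulr1 scalerDl addrA.
Qed.

Lemma is_derive_line f x v (t : R) : derivable f (t *: v + x) v ->
  is_derive t 1 (fun h : R => f (h *: v + x)) ('D_v f (t *: v + x)).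
Proof.
move=> df; apply: DeriveDef.
  by rewrite /derivable line_quotient.
by rewrite /derive line_quotient.
Qed.

Lemma is_derive_comp f x v (h : R -> R) : derivable f x v -> derivable h (f x) 1 ->
  is_derive x v (h \o f) ((h^`()%classic (f x)) * 'D_v f x).
Proof.
move=> df dh.
have E0 : x = 0 *: v + x by rewrite scale0r add0r.
have df0 : derivable f (0 *: v + x) v by rewrite -E0.
have /= l0 := is_derive_line df0; rewrite -E0 in l0.
have dh0 : is_derive (f (0 *: v + x)) 1 h (h^`()%classic (f x)).
  by rewrite -E0; apply: DeriveDef => //; rewrite derive1E.
have [d1 d2] := is_derive1_comp dh0 l0.
apply: DeriveDef.
  by apply/derivable1P.
by rewrite -d2 -[in LHS](add0r x) -(scale0r v) /derive -(line_quotient (h \o f)).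
Qed.

End Lines.

Section Ck.
Variable M : nat.
Implicit Types (X : set 'cV[R]_M) (f g : 'cV[R]_M -> R).

Lemma Ck_cont k X f : Ck k X f -> forall x, X x -> {for x, continuous f}.
Proof. by case: k => [|k] []. Qed.

Lemma CkW k X f : Ck k.+1 X f -> Ck k X f.
Proof.
elim: k f => [|k IH] f [cf df]; split=> // i.
by have [d1 d2] := df i; split=> //; apply: IH.
Qed.

Lemma Ck_subset k X Y f : X `<=` Y -> Ck k Y f -> Ck k X f.
Proof.
move=> XY; elim: k f => [|k IH] f [cf df]; split=> //; do ?[by move=> x /XY; apply: cf].
by move=> i; have [d1 d2] := df i; split; [move=> x /XY; apply: d1 | apply: IH].
Qed.

Lemma Ck_deriv k X f i : Ck k.+1 X f -> Ck k X ('D_(basis_vec R i) f).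
Proof. by move=> [_ /(_ i)[]]. Qed.

Lemma Ck_derivable k X f i x : Ck k.+1 X f -> X x ->
  derivable f x (basis_vec R i).
Proof. by move=> [_ /(_ i)[d _]] Xx; apply: d. Qed.

Lemma Ck_cst k (c : R) : Ck k setT (fun _ : 'cV[R]_M => c).
Proof.
elim: k c => [|k IH] c; split=> //; do ?by move=> x _; apply: cst_continuous.
move=> i; split=> [x _|]; first exact: derivable_cst.
rewrite (_ : 'D_ _ _ = fun=> 0) //.
by apply/funext => x; apply: derive_cst.
Qed.

Lemma is_derive_coord (j : 'I_M) (x v : 'cV[R]_M) :
  is_derive x v (fun z : 'cV[R]_M => z j 0) (v j 0).
Proof.
have E : (fun h : R => h^-1 *: (((fun z : 'cV[R]_M => z j 0) \o shift x) (h *: v)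
           - x j 0)) @ 0^' --> v j 0.
  apply: cvg_near_cst.
  near=> h => /=; rewrite !mxE addrK -[_ *: _]/(_ * _) mulKf //.
  by near: h; apply: nbhs_dnbhs_neq.
apply: DeriveDef; last exact: cvg_lim E.
by apply/cvg_ex; exists (v j 0).
Unshelve. all: by end_near. Qed.

Lemma Ck_coord k (j : 'I_M) : Ck k setT (fun z : 'cV[R]_M => z j 0).
Proof.
have cj x : {for x, continuous (fun z : 'cV[R]_M => z j 0)}.
  exact: coord_continuous.
case: k => [|k]; split=> // i; split=> [x _|].
  by have [] := is_derive_coord j x (basis_vec R i).
rewrite (_ : 'D_ _ _ = fun=> basis_vec R i j 0); first exact: Ck_cst.
by apply/funext => x; have [_ ->] := is_derive_coord j x (basis_vec R i).
Qed.

Lemma CkD k f g : Ck k setT f -> Ck k setT g -> Ck k setT (fun z => f z + g z).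
Proof.
elim: k f g => [|k IH] f g hf hg.
  by split=> // x _; apply: continuousD; [exact: (Ck_cont hf I)|exact: (Ck_cont hg I)].
split=> [x _|i].
  by apply: continuousD; [exact: (Ck_cont hf I)|exact: (Ck_cont hg I)].
split=> [x _|].
  by apply: derivableD; [apply: (Ck_derivable hf I)|apply: (Ck_derivable hg I)].
rewrite (_ : 'D_ _ _ = fun x => 'D_(basis_vec R i) f x + 'D_(basis_vec R i) g x).
  by apply: IH; apply: Ck_deriv.
apply/funext => x.
by apply: deriveD; [apply: (Ck_derivable hf I)|apply: (Ck_derivable hg I)].
Qed.

Lemma CkM k f g : Ck k setT f -> Ck k setT g -> Ck k setT (fun z => f z * g z).
Proof.
elim: k f g => [|k IH] f g hf hg.
  by split=> // x _; apply: continuousM; [exact: (Ck_cont hf I)|exact: (Ck_cont hg I)].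
split=> [x _|i].
  by apply: continuousM; [exact: (Ck_cont hf I)|exact: (Ck_cont hg I)].
split=> [x _|].
  by apply: derivableM; [apply: (Ck_derivable hf I)|apply: (Ck_derivable hg I)].
rewrite (_ : 'D_ _ _ = fun x => f x * 'D_(basis_vec R i) g x +
                              g x * 'D_(basis_vec R i) f x).
  by apply: CkD; apply: IH; do ?[exact: Ck_deriv | exact: CkW].
apply/funext => x.
by apply: deriveM; [apply: (Ck_derivable hf I)|apply: (Ck_derivable hg I)].
Qed.

Lemma Ck_sum k (I : Type) (r : seq I) (P : pred I) (F : I -> 'cV[R]_M -> R) :
  (forall i, P i -> Ck k setT (F i)) ->
  Ck k setT (fun z => \sum_(i <- r | P i) F i z).
Proof.
move=> hF; elim: r => [|i r IH].
  rewrite [X in Ck _ _ X](_ : _ = fun=> 0); first exact: Ck_cst.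
  by apply/funext => z; rewrite big_nil.
rewrite [X in Ck _ _ X](_ : _ =
  fun z => (if P i then F i z else 0) + \sum_(i <- r | P i) F i z); last first.
  by apply/funext => z; rewrite big_cons; case: ifP => // _; rewrite add0r.
by apply: CkD => //; case Pi: (P i); [apply: hF|apply: Ck_cst].
Qed.

Lemma Ck_real_derive k (h : R -> R) : Ck_real k.+1 h -> Ck_real k (h^`()%classic).
Proof.
move=> [d c]; have E i : ((h^`())^`(i))%classic = (h^`(i.+1))%classic.
  by rewrite derive1Sn.
by split=> [i y ik|]; rewrite E //; apply: d.
Qed.

Lemma Ck_realW k (h : R -> R) : Ck_real k.+1 h -> Ck_real k h.
Proof.
move=> [d c]; split=> [i y ik|y]; first by apply: d; apply: ltnW.
by apply: differentiable_continuous; apply/derivable1_diffP; apply: d.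
Qed.

Lemma Ck_real_cont k (h : R -> R) : Ck_real k h -> continuous h.
Proof. by elim: k => [[] //|k IH] /Ck_realW. Qed.

Lemma Ck_comp k (h : R -> R) f : Ck_real k h -> Ck k setT f ->
  Ck k setT (fun z => h (f z)).
Proof.
elim: k h f => [|k IH] h f hh hf; have ch := Ck_real_cont hh.
  by split=> // x _; apply: continuous_comp; [exact: (Ck_cont hf I)|exact: ch].
have D i x : is_derive x (basis_vec R i) (h \o f)
   ((h^`()%classic (f x)) * 'D_(basis_vec R i) f x).
  apply: is_derive_comp; first exact: Ck_derivable hf I.
  by have [/(_ 0%N (f x) isT)] := hh.
split=> [x _|i].
  by apply: continuous_comp; [exact: (Ck_cont hf I)|exact: ch].
split=> [x _|].
  by have [] := D i x.
rewrite (_ : 'D_ _ _ = fun x => h^`()%classic (f x) * 'D_(basis_vec R i) f x).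
  apply: CkM; last exact: Ck_deriv.
  by apply: IH; [apply: Ck_real_derive|apply: CkW].
by apply/funext => x; have [_] := D i x.
Qed.

End Ck.
End Regularity.

(** * Uniform strict differentiability on cubes *)

Section StrictDifferentiability.
Variables (R : realType) (M : nat).
Implicit Types (f g : 'cV[R]_M -> R) (z c : 'cV[R]_M).

(** Closed cubes, so that [r = 0] is meaningful; the balls of the topology are open, whence the
    factor 2 in [ball_nearby]. *)
Definition nearby (N : nat) (r : R) (z z' : 'cV[R]_N) : Prop :=
  forall i, `|z i 0 - z' i 0| <= r.

Lemma ball_nearby (r : R) z z' : 0 < r -> nearby r z z' -> ball z (r *+ 2) z'.
Proof.
move=> r0 h; split=> [|i j]; first by rewrite mulrn_wgt0.
by rewrite (ord1 j) /ball /=; apply: le_lt_trans (h i) _; rewrite mulr2n ltrDl.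
Qed.

Lemma cube_compact c (r : R) : compact [set z | nearby r z c].
Proof.
have ct : continuous (fun v : 'rV[R]_M => v^T : 'cV[R]_M).
  move=> v A /nbhs_ballP[e /= e0 he]; apply/nbhs_ballP; exists e => // w [_ h].
  by apply: he; split=> // i j; rewrite !mxE; apply: h.
have := continuous_compact (continuous_subspaceT ct)
  (rV_compact (fun i => @segment_compact R (c i 0 - r) (c i 0 + r))).
congr compact; apply/seteqP; split=> [_ [v h <-] i|z h].
  by rewrite mxE; have := h i; rewrite /= in_itv /= ler_distl.
exists z^T; last by rewrite trmxK.
by move=> i; rewrite /= in_itv /= mxE -ler_distl; apply: h.
Unshelve. all: by end_near. Qed.

(** Heine-Cantor, by the near-covering form of compactness with the radius as the parameter tending
    to 0. Only [z] is confined to the cube; [z'] may leave it. *)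
Lemma uniform_continuity f c (r e : R) : (forall z, {for z, continuous f}) ->
  0 < e -> exists2 d, 0 < d & forall z z', nearby r z c -> nearby d z z' ->
  `|f z - f z'| <= e.
Proof.
move=> cf e0.
have /compact_near_coveringP/(_ R (0^'+) (fun d z => forall z', nearby d z z' ->
  `|f z - f z'| <= e) _) := @cube_compact c r.
case.
  move=> z _; have e2 : 0 < e / 2 by rewrite divr_gt0.
  have /cvgrPdist_le /(_ _ e2) /nbhs_ballP [d /= d0 hd] := cf z.
  have d3 : 0 < d / 3 by rewrite divr_gt0.
  (* One third of [d] is spent on reaching [z1], two thirds on the way from [z1] to [z2], as
     [ball_nearby] doubles the radius. *)
  exists (ball z (d / 3), [set t | 0 < t < d / 6]) => /=.
    split; first exact: nbhsx_ballx.
    near=> t; apply/andP; split; near: t; first exact: nbhs_right_gt.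
    by apply: nbhs_right_lt; rewrite divr_gt0.
  move=> [z1 t] /= [hz1 /andP[t0 td]] z2 h12.
  have b1 : ball z d z1 by apply: le_ball hz1; lra.
  have b2 : ball z d z2.
    have -> : d = d / 3 + (d / 3) *+ 2 by rewrite mulr2n; lra.
    apply: ball_triangle hz1 _; apply: ball_nearby => // i.
    by apply: le_trans (h12 i) _; lra.
  have := hd _ b1; have := hd _ b2; rewrite /= distrC => h2 h1.
  rewrite -(subrKA (f z)) [e]splitr; apply: le_trans (ler_normD _ _) _.
  by rewrite lerD // distrC.
move=> d /= d0 hd; exists (d / 2); first by rewrite divr_gt0.
move=> z z' hz hzz'; apply: (hd (d / 2)) => //=; last by rewrite divr_gt0.
by rewrite /ball /= sub0r normrN ger0_norm ?divr_ge0 ?ltW //; lra.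
Unshelve. all: by end_near. Qed.

Lemma common_radius (I : finType) (P : I -> R -> Prop) :
  (forall i d d', d' <= d -> P i d -> P i d') ->
  (forall i, exists2 d, 0 < d & P i d) ->
  exists2 d, 0 < d & forall i, P i d.
Proof.
move=> Pmono hP.
have /choice[d hd] : forall i, exists d, 0 < d /\ P i d.
  by move=> i; have [d d0 Pd] := hP i; exists d.
exists (\big[Order.min/1]_i d i).
  by apply/bigmin_gtP; split=> [|i _]; [exact: ltr01 | have [] := hd i].
by move=> i; have [_] := hd i; apply: Pmono; apply: bigmin_le.
Qed.

Lemma partial_mean_value f i z (t : R) : Ck 1 setT f ->
  exists2 u, `|u| <= `|t| & f (t *: basis_vec R i + z) - f z =
    'D_(basis_vec R i) f (u *: basis_vec R i + z) * t.
Proof.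
move=> hf; set v := basis_vec R i; pose phi h := f (h *: v + z).
have dphi (h : R) : is_derive h 1 phi ('D_v f (h *: v + z)).
  by apply: is_derive_line; apply: (Ck_derivable hf I).
have cphi : continuous phi.
  by move=> h; apply: differentiable_continuous; apply/derivable1_diffP.
have f0 : f z = phi 0 by rewrite /phi scale0r add0r.
rewrite f0 -/(phi t); case: (leP 0 t) => [t0|/ltW t0].
  have [u /[!in_itv] /andP[u0 ut]] := MVT_segment t0 (fun x _ => dphi x)
    (continuous_subspaceT cphi).
  by rewrite subr0 => ->; exists u => //; rewrite !ger0_norm.
have [u /[!in_itv] /andP[tu u0]] := MVT_segment t0 (fun x _ => dphi x)
    (continuous_subspaceT cphi).
rewrite sub0r mulrN => E; exists u; first by rewrite !ler0_norm // lerN2.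
by rewrite -[LHS]opprB E opprK.
Qed.

(** The mean value theorem, applied to one coordinate at a time, turns the increments into partial
    derivatives at points close to [z']. Their uniform continuity makes [d] independent of the base
    point [z'], as is required when neither point is fixed. *)
Lemma strict_derivative f c (r e : R) : Ck 1 setT f -> 0 < e ->
  exists2 d, 0 < d & forall z z' rho, nearby r z' c -> 0 <= rho <= d ->
  nearby rho z z' ->
  `|f z - f z' - \sum_i 'D_(basis_vec R i) f z' * (z i 0 - z' i 0)| <= e * rho.
Proof.
(* Each of the [M] coordinates costs [e' * rho]; [M.+1] avoids a division by zero. *)
move=> hf e0; pose e' := e / M.+1%:R.
have e'0 : 0 < e' by rewrite divr_gt0.
pose P i d := forall z z', nearby r z c -> nearby d z z' ->
  `|'D_(basis_vec R i) f z - 'D_(basis_vec R i) f z'| <= e'.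
have [d d0 hd] : exists2 d, 0 < d & forall i, P i d.
  apply: common_radius => [i d d' dd' Pd z z' hz hzz'|i].
    by apply: Pd => // j; apply: le_trans dd'.
  apply: uniform_continuity => // z.
  exact: (Ck_cont (Ck_deriv i hf) I).
exists d => // z z' rho hz' /andP[rho0 rhod] hzz'.
(* A path from [z'] to [z] along the coordinate axes, in [M] steps. *)
pose y k : 'cV[R]_M := \col_i if (i < k)%N then z i 0 else z' i 0.
have -> : f z = f (y M).
  by congr f; apply/matrixP => i j; rewrite (ord1 j) mxE ltn_ord.
have {1}-> : f z' = f (y 0) by congr f; apply/matrixP => i j; rewrite (ord1 j) mxE.
rewrite -(telescope_sumr (fun k => f (y k))) // big_mkord -sumrB.
apply: le_trans (ler_norm_sum _ _ _) _.
have -> : e * rho = \sum_(i < M) e' * rho + e' * rho.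
  have -> : e = M.+1%:R * e' by rewrite mulrC divfK.
  by rewrite sumr_const card_ord -mulr_natl -natr1; ring.
rewrite -[leLHS]addr0; apply: lerD; last by rewrite mulr_ge0 // ltW.
apply: ler_sum => k _; set t := z k 0 - z' k 0.
have -> : y k.+1 = t *: basis_vec R k + y k.
  apply/matrixP => i j; rewrite (ord1 j) !mxE eqxx andbT ltnS leq_eqVlt.
  have [->|ik] := eqVneq i k; first by rewrite eqxx ltnn /= mulr1 subrK.
  by rewrite val_eqE (negbTE ik) /= mulr0 add0r.
have [u ut ->] := partial_mean_value k (y k) t hf.
rewrite -mulrBl normrM ler_pM // ?hzz' // distrC.
apply: hd => // i; rewrite !mxE eqxx andbT.
have [->|ik] := eqVneq i k.
  rewrite ltnn mulr1 opprD addrCA subrr addr0 normrN.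
  by apply: le_trans ut _; apply: le_trans (hzz' k) _.
rewrite mulr0 add0r; case: ifP => _; last by rewrite subrr normr0 ltW.
by rewrite distrC; apply: le_trans rhod.
Qed.

End StrictDifferentiability.

(** * Lebesgue null sets *)

Section NullSets.
Variables (R : realType) (N : nat).
(* For N = 0 every box has volume 1 (an empty product) and no set is null. *)
Hypothesis N_gt0 : (0 < N)%N.
Implicit Types (E : set 'cV[R]_N).

Definition box (lo hi : 'cV[R]_N) : set 'cV[R]_N :=
  [set p | forall i, lo i 0 <= p i 0 <= hi i 0].

Definition volume (lo hi : 'cV[R]_N) : R := \prod_(i < N) (hi i 0 - lo i 0).

Lemma volume_ge0 (lo hi : 'cV[R]_N) : (forall i, lo i 0 <= hi i 0) -> 0 <= volume lo hi.
Proof. by move=> h; apply: prodr_ge0 => i _; rewrite subr_ge0. Qed.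

Lemma null_subset E E' : E `<=` E' -> lebesgue_null E' -> lebesgue_null E.
Proof.
move=> EE' hE e /hE[lo [hi [h1 h2 h3]]]; exists lo, hi; split=> //.
exact: subset_trans h2.
Qed.

Lemma null_countable_cover E :
  (forall e : R, 0 < e -> exists (T : countType) (lo hi : T -> 'cV[R]_N),
    [/\ forall t i, lo t i 0 <= hi t i 0,
        forall p, E p -> exists t, box (lo t) (hi t) p &
        (\esum_(t in setT) (volume (lo t) (hi t))%:E <= e%:E)%E]) ->
  lebesgue_null E.
Proof.
move=> hE e /hE[T [lo [hi [lohi Ecov vol]]]].
(* Numbers that encode no element of [T] get the box consisting of the origin, of volume zero as
   [N > 0]. *)
pose ext (f : T -> 'cV[R]_N) m := if pickle_inv m is Some t then f t else 0.
have ext_le m i : ext lo m i 0 <= ext hi m i 0.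
  by rewrite /ext; case: pickle_inv => [t|]; rewrite ?mxE.
exists (ext lo), (ext hi); split=> //.
  by move=> p /Ecov[t ht]; exists (pickle t) => //; rewrite /ext pickleK_inv.
rewrite nneseries_esumT; last by move=> m; rewrite lee_fin volume_ge0.
apply: le_trans vol.
rewrite (_ : (fun t => _) = (fun t : T => (volume (ext lo (pickle t)) (ext hi (pickle t)))%:E)); last first.
  by apply/funext => t; rewrite /ext pickleK_inv.
rewrite -(@esum_image _ _ _ setT (@pickle T)
  (fun m => (volume (ext lo m) (ext hi m))%:E)); last first.
  by move=> x y _ _; apply: (pcan_inj pickleK_inv).
rewrite esum_mkcond [leRHS]esum_mkcond; apply: le_esum => m _.
rewrite in_setT; case: ifPn => [_|]; first exact: lexx.
rewrite notin_setE /= => hm; rewrite lee_fin le_eqVlt; apply/orP; left.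
rewrite /volume /ext; case E0: (pickle_inv m) => [t|].
  by case: hm; exists t => //; have := @pickle_invK T m; rewrite /oapp E0.
by rewrite (eq_bigr (fun=> 0)) => [|i _]; rewrite ?mxE ?subr0 // prodr_const
  card_ord expr0n gtn_eqF.
Qed.

Lemma null_bigcup (E : nat -> set 'cV[R]_N) :
  (forall m, lebesgue_null (E m)) -> lebesgue_null (\bigcup_m E m).
Proof.
move=> hE; apply: null_countable_cover => e e0.
have em0 m : 0 < e / (2 ^ m.+1)%:R by rewrite divr_gt0 // ltr0n expn_gt0.
have /choice[lo /choice[hi h]] m := hE m _ (em0 m).
exists (nat * nat)%type, (fun k => lo k.1 k.2), (fun k => hi k.1 k.2); split.
- by move=> [m k] i /=; have [+ _ _] := h m; apply.
- move=> p [m _ /=]; have [_ + _] := h m => /[apply] -[k _ hk].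
  by exists (m, k).
have lohi m k i : lo m k i 0 <= hi m k i 0 by have [+ _ _] := h m; apply.
have := @esum_esum R nat nat setT (fun=> setT)
  (fun m k => (volume (lo m k) (hi m k))%:E) _.
rewrite (_ : setT `*`` _ = setT); last by apply/seteqP; split.
move=> <-; last by move=> m k _ _; rewrite lee_fin volume_ge0.
apply: le_trans (epsilon_trick0 xpredT (ltW e0)).
rewrite -nneseries_esumT; last first.
  by move=> m; apply: esum_ge0 => k _; rewrite lee_fin volume_ge0.
apply: lee_nneseries => [m _ _|m _].
  by apply: esum_ge0 => k _; rewrite lee_fin volume_ge0.
rewrite -nneseries_esumT; last by move=> k; rewrite lee_fin volume_ge0.
by have [_ _] := h m.
Qed.

Lemma null_finite_cover E :
  (forall e : R, 0 < e -> exists (T : finType) (lo hi : T -> 'cV[R]_N),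
    [/\ forall t i, lo t i 0 <= hi t i 0,
        forall p, E p -> exists t, box (lo t) (hi t) p &
        \sum_t volume (lo t) (hi t) <= e]) ->
  lebesgue_null E.
Proof.
move=> hE; apply: null_countable_cover => e /hE[T [lo [hi [lohi cov vol]]]].
exists T, lo, hi; split=> //.
rewrite (_ : setT = [set` index_enum T]); last first.
  by apply/seteqP; split=> t //= _; rewrite mem_index_enum.
rewrite esum_fset; [|exact: finite_seq|by move=> t _; rewrite lee_fin volume_ge0].
rewrite (_ : (\sum_(t \in _) _ = \sum_t (volume (lo t) (hi t))%:E)%E).
  by rewrite sumEFin lee_fin.
by symmetry; apply: fsbig_seq; apply: index_enum_uniq.
Qed.

Lemma null_set0 : lebesgue_null (set0 : set 'cV[R]_N).
Proof.
apply: null_countable_cover => e e0.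
exists void, (fun=> 0), (fun=> 0); split=> //.
by rewrite (_ : setT = set0) ?esum_set0 ?lee_fin ?ltW //; apply/seteqP; split=> -[].
Qed.

Lemma null_countable_union (T : countType) (E : T -> set 'cV[R]_N) :
  (forall t, lebesgue_null (E t)) -> lebesgue_null (\bigcup_t E t).
Proof.
move=> hE; pose E' m := if pickle_inv m is Some t then E t else set0.
apply: (@null_subset _ (\bigcup_m E' m)).
  by move=> p [t _ pt]; exists (pickle t) => //; rewrite /E' pickleK_inv.
apply: null_bigcup => m; rewrite /E'; case: pickle_inv => [t|] //.
exact: null_set0.
Qed.

End NullSets.

(** * Coverings by thin slabs *)

Section CriticalValues.
Variables (R : realType) (N : nat).
Hypothesis N_gt0 : (0 < N)%N.

Lemma subinterval (K : nat) (eta y : R) : 0 <= eta ->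
  0 <= y <= K.+1%:R * eta ->
  exists k : 'I_K.+1, k%:R * eta <= y <= k.+1%:R * eta.
Proof.
move=> eta0; elim: K => [|K IH] /andP[y0 yK].
  by exists ord0; rewrite mul0r y0.
case: (leP y (K.+1%:R * eta)) => [yK'|/ltW Ky].
  have [|k hk] := IH; first by rewrite y0.
  by exists (widen_ord (leqnSn _) k).
by exists ord_max; rewrite Ky.
Qed.

Lemma archimedean_quotient (x e : R) : 0 < e -> exists K : nat, x / K.+1%:R <= e.
Proof.
move=> e0; exists (Num.truncn (x / e)).
by rewrite ler_pdivrMr // mulrC -ler_pdivrMr // ltW // truncnS_gt.
Qed.

(** The coordinates other than [i0] are cut into [K.+1] pieces each. As [v i0 0 = 1], their pieces
    determine the coordinate [i0] up to an error of order [h / K.+1], so boxes of that size, [K.+1]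
    in each direction but one, suffice. *)
Lemma slab_cover (C h : R) (K : nat) (i0 : 'I_N) (v p0 : 'cV[R]_N) :
  0 <= C -> 0 <= h -> v i0 0 = 1 -> (forall i, `|v i 0| <= 1) ->
  exists lo hi : {ffun 'I_N -> 'I_K.+1} -> 'cV[R]_N,
  [/\ forall u i, lo u i 0 <= hi u i 0,
      forall p, nearby (C * h) p p0 ->
        `|\sum_i v i 0 * (p i 0 - p0 i 0)| <= h / K.+1%:R ->
        exists u, box (lo u) (hi u) p &
      \sum_u volume (lo u) (hi u) <= (2 * (1 + N%:R * C) * h) ^+ N / K.+1%:R].
Proof.
move=> C0 h0 vi0 v1; set k1 : R := K.+1%:R.
have k0 : 0 < k1 by rewrite ltr0n.
(* [eta] is half the side of a piece; [tau] adds to the half-thickness of the slab the error of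
   moving the other coordinates to the centres of their pieces. *)
pose eta := C * h / k1; pose tau := h / k1 + N%:R * eta.
have eta0 : 0 <= eta by rewrite divr_ge0 ?mulr_ge0 // ltW.
have tau0 : 0 <= tau.
  by apply: addr_ge0; [apply: divr_ge0 => //; apply: ltW | apply: mulr_ge0].
pose w (k : 'I_K.+1) := - (C * h) + (2 * k%:R + 1) * eta.
(* Letting [u] range over all functions turns the sum of volumes into a product of sums. To count no
   box repeatedly, those with [u i0 != ord0] are made flat in direction [i0]. *)
pose s i (k : 'I_K.+1) :=
  if i == i0 then (if k == ord0 then tau else 0) else eta.
pose ctr (u : {ffun 'I_N -> 'I_K.+1}) i :=
  p0 i 0 + (if i == i0 then - \sum_(j | j != i0) v j 0 * w (u j) else w (u i)).
have s0 i k : 0 <= s i k by rewrite /s; case: ifP => // _; case: ifP.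
exists (fun u => \col_i (ctr u i - s i (u i))), (fun u => \col_i (ctr u i + s i (u i))).
split.
- by move=> u i; rewrite !mxE lerD2l ge0_cp.
- move=> p hp hv.
  have /choice[u0 hu0] i : exists k : 'I_K.+1, `|p i 0 - p0 i 0 - w k| <= eta.
    have [||k] := @subinterval K (2 * eta) (p i 0 - p0 i 0 + C * h).
    - by rewrite mulr_ge0.
    - have := hp i; rewrite ler_norml => /andP[h1 h2].
      rewrite -[K.+1%:R]/k1; have -> : k1 * (2 * eta) = 2 * (C * h).
        by rewrite /eta; field; apply: lt0r_neq0.
      by apply/andP; split; lra.
    rewrite -natr1 => /andP[h1 h2]; exists k; rewrite ler_norml /w.
    by apply/andP; split; lra.
  exists [ffun i => if i == i0 then ord0 else u0 i] => i.
  rewrite !mxE !ffunE -ler_distl /ctr /s.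
  have [->|ii0] := eqVneq i i0; last by rewrite ffunE (negbTE ii0) opprD addrA.
  rewrite eqxx.
  have -> : p i0 0 - (p0 i0 0 - \sum_(j | j != i0) v j 0 *
      w ([ffun i => if i == i0 then ord0 else u0 i] j)) =
    \sum_i v i 0 * (p i 0 - p0 i 0) -
    \sum_(j | j != i0) v j 0 * (p j 0 - p0 j 0 - w (u0 j)).
    rewrite [X in _ = X - _](bigD1 i0) //= vi0 mul1r -addrA -sumrB.
    rewrite opprD addrA opprK; congr (_ + _); apply: eq_bigr => j ji0.
    by rewrite ffunE (negbTE ji0); ring.
  apply: le_trans (ler_normB _ _) _; apply: lerD => //.
  apply: le_trans (ler_norm_sum _ _ _) _.
  apply: le_trans (_ : \sum_(j | j != i0) eta <= _).
    apply: ler_sum => j _; rewrite normrM -[eta]mul1r.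
    by apply: ler_pM.
  rewrite sumr_const -[leLHS]mulr_natl ler_wpM2r // ler_nat.
  by rewrite -[leqRHS]card_ord max_card.
rewrite (eq_bigr (fun u : {ffun _ -> _} => \prod_i (2 * s i (u i)))); last first.
  by move=> u _; apply: eq_bigr => i _; rewrite !mxE; ring.
rewrite -(bigA_distr_bigA (fun i k => 2 * s i k)) /=.
have NC : 0 <= N%:R * C by rewrite mulr_ge0.
have N1 : (1 : R) <= N%:R by rewrite ler1n.
rewrite (bigD1 i0) //= /s eqxx.
rewrite (bigD1 ord0) //= big1 ?addr0; last first.
  by move=> k /negbTE->; rewrite mulr0.
have -> : 2 * tau = (2 * (1 + N%:R * C) * h) / k1 by rewrite /tau /eta; ring.
rewrite mulrAC ler_wpM2r ?invr_ge0 ?(ltW k0) //.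
have := @prodr_const R _ [pred i : 'I_N | true] (2 * (1 + N%:R * C) * h).
rewrite cardE; rewrite -cardE card_ord => <-; rewrite [leRHS](bigD1 i0) //=.
have Ah0 : 0 <= 2 * (1 + N%:R * C) * h by rewrite !mulr_ge0 // addr_ge0.
apply: ler_wpM2l => //; apply: ler_prod => i ii0.
rewrite (negbTE ii0) sumr_const card_ord.
have -> : (2 * eta) *+ K.+1 = 2 * C * h.
  by rewrite -[LHS]mulr_natl -/k1 /eta; field; apply: lt0r_neq0.
rewrite !mulr_ge0 //= ler_wpM2r // ler_wpM2l //.
by rewrite -[C in leLHS]mul1r; nra.
Qed.

(** A covering argument as for Sard's theorem: [S] is a Lipschitz graph over [q]. A cell of side [h]
    in the [q]-cube is sent into a cube of size of order [h], and there into a slab of thickness of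
    order [h / K.+1]. The number of cells is of order [h ^- N], so the total volume is of order
    [1 / K.+1], whatever the mesh. *)
Lemma null_slabs (S : 'cV[R]_N -> 'cV[R]_N -> Prop) (c : 'cV[R]_N) (r C : R) :
  0 < r -> 0 <= C ->
  (forall q p, S q p -> nearby r q c) ->
  (forall q p q' p' rho, S q p -> S q' p' -> 0 <= rho -> nearby rho q q' ->
    nearby (C * rho) p p') ->
  (forall e, 0 < e -> exists2 d, 0 < d & forall q0 p0, S q0 p0 ->
    exists i0 (v : 'cV[R]_N), [/\ v i0 0 = 1, forall i, `|v i 0| <= 1 &
      forall q p rho, S q p -> 0 <= rho <= d -> nearby rho q q0 ->
        `|\sum_i v i 0 * (p i 0 - p0 i 0)| <= e * rho]) ->
  lebesgue_null [set p | exists q, S q p].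
Proof.
move=> r0 C0 Sc Slip Sslab; apply: null_finite_cover => // e e0.
pose a := 2 * r; pose A := 2 * (1 + N%:R * C).
have a0 : 0 < a by rewrite mulr_gt0.
(* [K] is fixed first, by the total volume; the mesh [h] is then taken below the [d] that belongs to
   the thickness [K.+1%:R^-1]. *)
have [K hK] := archimedean_quotient ((A * a) ^+ N) e0.
have [d d0 hd] := Sslab K.+1%:R^-1 (ltac:(by rewrite invr_gt0)).
have [M hM] := archimedean_quotient a d0.
set h := a / M.+1%:R in hM.
have h0 : 0 < h by rewrite divr_gt0.
have aE : a = M.+1%:R * h by rewrite mulrC divfK.
pose cell (t : {ffun 'I_N -> 'I_M.+1}) (q : 'cV[R]_N) :=
  forall i, (t i)%:R * h <= q i 0 - (c i 0 - r) <= (t i).+1%:R * h.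
have /choice[lo /choice[hi H]] (t : {ffun 'I_N -> 'I_M.+1}) :
  exists lo hi : {ffun 'I_N -> 'I_K.+1} -> 'cV[R]_N,
  [/\ forall u i, lo u i 0 <= hi u i 0,
      forall q p, S q p -> cell t q -> exists u, box (lo u) (hi u) p &
      \sum_u volume (lo u) (hi u) <= (A * h) ^+ N / K.+1%:R].
  have [[q0 [p0 [S0 c0]]]|none] := pselect (exists q p, S q p /\ cell t q).
    have [i0 [v [vi0 v1 hv]]] := hd _ _ S0.
    have [lo [hi [H1 H2 H3]]] := slab_cover K p0 C0 (ltW h0) vi0 v1.
    exists lo, hi; split=> // q p Sqp cq.
    have qq0 : nearby h q q0.
      move=> i; have /andP[] := cq i; have /andP[] := c0 i; rewrite -natr1.
      by rewrite mulrDl mul1r ler_norml => *; apply/andP; split; lra.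
    apply: H2; first exact: Slip Sqp S0 (ltW h0) qq0.
    by rewrite mulrC; apply: hv qq0; rewrite // ltW.
  (* A cell without points of the graph needs no covering, only boxes within the volume bound. *)
  have [lo [hi [H1 _ H3]]] := @slab_cover C h K (Ordinal N_gt0) (const_mx 1) 0
    C0 (ltW h0) (mxE _ _ _ _) (fun i => ltac:(by rewrite mxE normr1)).
  by exists lo, hi; split=> // q p Sqp cq; case: none; exists q, p.
exists ({ffun 'I_N -> 'I_M.+1} * {ffun 'I_N -> 'I_K.+1})%type,
  (fun tu => lo tu.1 tu.2), (fun tu => hi tu.1 tu.2); split.
- by move=> [t u] i /=; have [+ _ _] := H t; apply.
- move=> p [q Sqp].
  have /choice[t ht] i : exists k : 'I_M.+1,
      k%:R * h <= q i 0 - (c i 0 - r) <= k.+1%:R * h.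
    apply: subinterval; first exact: ltW.
    by have := Sc _ _ Sqp i; rewrite -aE /a ler_norml => /andP[*]; apply/andP; split; lra.
  have [_ + _] := H [ffun i => t i].
  move=> /(_ _ _ Sqp)[i|u hu]; first by rewrite ffunE.
  by exists ([ffun i => t i], u).
rewrite -(pair_bigA _ (fun t u => volume (lo t u) (hi t u))) /=.
apply: le_trans (_ : \sum_(t : {ffun 'I_N -> 'I_M.+1}) (A * h) ^+ N / K.+1%:R <= _).
  by apply: ler_sum => t _; have [] := H t.
apply: le_trans hK; rewrite sumr_const card_ffun !card_ord -mulrnAl -[_ *+ _]mulr_natl.
by rewrite natrX -exprMn mulrCA -aE.
Qed.

End CriticalValues.

(** * Parametric transversality *)

Section Transversality.
Variable R : realType.

(** [Ck] speaks of the coordinate directions only; [strict_derivative] for the increments [t *: v]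
    yields the other directions. *)
Lemma derive_basis (M : nat) (f : 'cV[R]_M -> R) (z v : 'cV[R]_M) :
  Ck 1 setT f -> 'D_v f z = \sum_i 'D_(basis_vec R i) f z * v i 0.
Proof.
move=> hf; apply: cvg_lim => //; set L := \sum_i _.
pose V := 1 + \sum_i `|v i 0|.
have V0 : 0 < V by rewrite ltr_pwDl // sumr_ge0.
have vV i : `|v i 0| <= V.
  by rewrite /V (bigD1 i) //= addrCA lerDl addr_ge0 // sumr_ge0.
apply/cvgrPdist_le => e e0.
have eV : 0 < e / V by rewrite divr_gt0.
have [d d0 hd] := strict_derivative z 1 hf eV.
have dV : 0 < d / V by rewrite divr_gt0.
near=> t.
have t0 : t != 0 by near: t; apply: nbhs_dnbhs_neq.
have td : `|t| <= d / V.
  by near: t; apply: dnbhs0_le.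
have := hd (t *: v + z) z (`|t| * V) _ _ _.
rewrite (eq_bigr (fun i => t * ('D_(basis_vec R i) f z * v i 0))); last first.
  by move=> i _; rewrite !mxE addrK mulrCA.
rewrite -mulr_sumr -/L => h; rewrite /= distrC.
rewrite -(ler_pM2l (_ : 0 < `|t|)) ?normr_gt0 // -normrM mulrBr.
rewrite -[_ *: _]/(_ * _) mulVKf //.
have -> : `|t| * e = e / V * (`|t| * V) by field; rewrite gt_eqF.
apply: h => [i|| i].
- by rewrite subrr normr0.
- by rewrite mulr_ge0 ?(ltW V0) //= -ler_pdivlMr.
- by rewrite !mxE addrK normrM ler_wpM2l.
Unshelve. all: by end_near. Qed.

Lemma sum_codom (I J : finType) (h : I -> J) (F : J -> R) : injective h ->
  \sum_j F j = \sum_i F (h i) + \sum_(j | j \notin codom h) F j.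
Proof.
move=> hinj; rewrite (bigID (mem (codom h))) /=; congr (_ + _).
have u : uniq (codom h) by rewrite map_inj_uniq ?enum_uniq.
by rewrite -(big_uniq _ u) codomE big_map big_enum.
Qed.

(** A Lindelof argument: the cubes of radius [m.+1%:R^-1] centred at multiples of it are countably
    many, and every point of [B] lies in one that is contained in its given neighbourhood. *)
Lemma null_local (M N : nat) (N_gt0 : (0 < N)%N) (B : set 'cV[R]_M)
    (pr : 'cV[R]_M -> 'cV[R]_N) :
  (forall z0, B z0 -> exists2 rho, 0 < rho &
    lebesgue_null [set pr z | z in [set z | B z /\ nearby rho z z0]]) ->
  lebesgue_null (pr @` B).
Proof.
move=> hB.
pose cube (k : nat * {ffun 'I_M -> int}) := [set z : 'cV[R]_M |
  nearby (k.1.+1%:R^-1) z (\col_i ((k.2 i)%:~R / k.1.+1%:R))].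
(* With nullness as part of the condition every [E k] is null: a cube whose image is not null
   contributes the empty set. *)
pose E k := [set p | lebesgue_null (pr @` (B `&` cube k)) /\ (pr @` (B `&` cube k)) p].
apply: (@null_subset _ _ _ (\bigcup_k E k)); last first.
  apply: null_countable_union => // k.
  have [hk|hk] := pselect (lebesgue_null (pr @` (B `&` cube k))).
    by apply: (null_subset _ hk) => p [].
  by apply: (null_subset _ (@null_set0 R N N_gt0)) => p [/hk].
move=> _ [z0 Bz0 <-]; have [rho rho0 hrho] := hB _ Bz0.
have [m hm] := archimedean_quotient 2 rho0.
have m0 : 0 < m.+1%:R :> R by rewrite ltr0n.
pose k := (m, [ffun i => Num.floor (z0 i 0 * m.+1%:R)] : {ffun 'I_M -> int}).
have cz0 : cube k z0.
  move=> i; rewrite /k /= mxE ffunE.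
  have /andP[h1 h2] := floor_itv (z0 i 0 * m.+1%:R).
  rewrite -(ler_pM2r m0) mulVf ?gt_eqF // -[X in _ * X](gtr0_norm m0) -normrM.
  rewrite mulrBl divfK ?gt_eqF // ler_norml; rewrite intrD in h2.
  by apply/andP; split; lra.
exists k => //; split; last by exists z0.
apply: (null_subset _ hrho) => _ [z [Bz cz] <-]; exists z => //; split=> // i.
apply: le_trans hm; have := cz i; have := cz0 i.
set t := (\col__ _) i 0 => h1 h2.
have -> : z i 0 - z0 i 0 = (z i 0 - t) - (z0 i 0 - t) by ring.
by apply: le_trans (ler_normB _ _) _; rewrite mulr_natl mulr2n lerD.
Qed.

(** In [w = (w M - w (M - M0)) M0^-1] the second term is at most half the largest entry of [w] and
    is absorbed on the left. *)
Lemma stable_inverse (n : nat) (M0 : 'M[R]_n) : M0 \in unitmx ->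
  exists C eta : R, [/\ 0 <= C, 0 < eta & forall M : 'M[R]_n,
    (forall i j, `|M i j - M0 i j| <= eta) ->
    forall (w : 'rV[R]_n) s, (forall k, `|(w *m M) 0 k| <= s) ->
    forall k, `|w 0 k| <= C * s].
Proof.
move=> uM; pose b := \sum_i \sum_j `|invmx M0 i j|.
have b0 : 0 <= b by apply: sumr_ge0 => i _; apply: sumr_ge0.
have hb k : \sum_l `|invmx M0 l k| <= b.
  apply: ler_sum => l _; rewrite (bigD1 k) //= lerDl; exact: sumr_ge0.
have D0 : 0 < 2 * n.+1%:R * (b + 1) by rewrite !mulr_gt0 // ltr_wpDl.
(* The radius makes [b * n * eta] at most 1/2; [n.+1] and [b + 1] avoid divisions by zero. *)
exists (2 * b), (2 * n.+1%:R * (b + 1))^-1; split; rewrite ?mulr_ge0 ?invr_gt0 //.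
move=> M hM w s hw k.
pose om := \big[Order.max/0]_k `|w 0 k|.
have om0 : 0 <= om by apply: bigmax_ge_id.
have wom l : `|w 0 l| <= om by apply: le_bigmax.
suff : om <= 2 * b * s by apply: le_trans.
have s0 : 0 <= s by apply: le_trans (hw k).
suff : om <= b * (s + n%:R * om * (2 * n.+1%:R * (b + 1))^-1).
  have -> : b * (s + n%:R * om / (2 * n.+1%:R * (b + 1))) =
    b * s + (om / 2) * ((n%:R / n.+1%:R) * (b / (b + 1))).
    by field; rewrite nat1r pnatr_eq0 /= gt_eqF // ltr_wpDl.
  have q1 : (n%:R / n.+1%:R) * (b / (b + 1)) <= 1 :> R.
    apply: mulr_ile1; rewrite ?divr_ge0 ?addr_ge0 //.
      by rewrite ler_pdivrMr ?ltr0n // mul1r ler_nat.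
    by rewrite ler_pdivrMr ?ltr_wpDl // mul1r lerDl.
  have : (om / 2) * ((n%:R / n.+1%:R) * (b / (b + 1))) <= om / 2 * 1.
    by rewrite ler_wpM2l // divr_ge0.
  by move: (_ * _ * (_ * _)) => y; lra.
apply/bigmax_leP; split=> [|i _].
  by rewrite !mulr_ge0 // addr_ge0 // !mulr_ge0 // invr_ge0 ltW.
have -> : w = (w *m M - w *m (M - M0)) *m invmx M0.
  by rewrite mulmxBr opprB addrC subrK mulmxK.
rewrite mxE; apply: le_trans (ler_norm_sum _ _ _) _.
apply: le_trans (_ : \sum_l `|invmx M0 l i| *
  (s + n%:R * om / (2 * n.+1%:R * (b + 1))) <= _).
  apply: ler_sum => l _; rewrite normrM mulrC ler_wpM2l //.
  rewrite mxE; apply: le_trans (ler_normD _ _) _; apply: lerD => //.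
  rewrite mxE normrN mxE; apply: le_trans (ler_norm_sum _ _ _) _.
  set D := om * (2 * n.+1%:R * (b + 1))^-1.
  have -> : n%:R * om / (2 * n.+1%:R * (b + 1)) = \sum_(j < n) D.
    by rewrite sumr_const card_ord -[RHS]mulr_natl mulrA.
  apply: ler_sum => j _; rewrite normrM ler_pM // !mxE; exact: hM.
rewrite -mulr_suml ler_wpM2r // addr_ge0 // !mulr_ge0 // invr_ge0 ltW //.
Qed.

Section ParametricTransversality.
Variables (n N : nat) (N_gt0 : (0 < N)%N) (g : 'I_n -> 'cV[R]_(n + N) -> R).
Hypothesis g_C1 : forall j, Ck 1 setT (g j).

Local Notation D i j z := ('D_(basis_vec R i) (g j) z).

(** The first [n] coordinates of [z] are the variables, the last [N] the parameters. The third
    clause makes [g] a submersion in the parameters. *)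
Definition degenerate_zero (z : 'cV[R]_(n + N)) : Prop :=
  [/\ forall j, g j z = 0,
      (\matrix_(j, i) D (lshift N i) j z : 'M[R]_n) \notin unitmx &
      forall y : 'I_n -> R, exists eta : 'cV[R]_N,
        forall j, 'D_(col_mx 0 eta) (g j) z = y j].

Section Localization.
Variables (f : 'I_n -> 'I_N) (f_inj : injective f).

(* The parameters indexed by f are traded for the variables x. *)
Definition traded (z : 'cV[R]_(n + N)) : 'cV[R]_N :=
  \col_i if [pick k | f k == i] is Some k then z (lshift N k) 0
         else z (rshift n i) 0.

Definition partial_f (z : 'cV[R]_(n + N)) : 'M[R]_n :=
  \matrix_(k, j) D (rshift n (f k)) j z.

(** [traded] retains every coordinate of [z] except the parameters indexed by [f]. *)
Lemma traded_nearby r z z' : nearby r (traded z) (traded z') ->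
  forall i, i \notin codom (fun k => rshift n (f k)) -> `|z i 0 - z' i 0| <= r.
Proof.
move=> h i; case: (split_ordP i) => k -> hk.
  have := h (f k); rewrite !mxE; case: pickP => [l /eqP/f_inj->//|/(_ k)].
  by rewrite eqxx.
have := h k; rewrite !mxE; case: pickP => [l /eqP lk|//].
by case/negP: hk; rewrite -lk; apply: codom_f.
Qed.

(** The uniqueness half of the implicit function theorem, made quantitative. For two zeros, the
    linearised equations are solved for the parameters indexed by [f]; the remainder is a small
    multiple of the whole distance and is absorbed. The second conclusion will bound kernel
    vectors. *)
Lemma zeros_lipschitz (z0 : 'cV[R]_(n + N)) : partial_f z0 \in unitmx ->
  exists C rho : R, [/\ 0 <= C, 0 < rho,
  (forall z z' r, g^~ z =1 (fun=> 0) -> g^~ z' =1 (fun=> 0) ->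
    nearby rho z z0 -> nearby rho z' z0 -> 0 <= r ->
    nearby r (traded z) (traded z') -> nearby (C * r) z z') &
  (forall z, nearby rho z z0 -> forall (w : 'rV[R]_n) s,
    (forall k, `|(w *m (partial_f z)^T) 0 k| <= s) ->
    forall k, `|w 0 k| <= C * s)].
Proof.
move=> uM; have uMT : (partial_f z0)^T \in unitmx by rewrite unitmx_tr.
have [C1 [eta1 [C10 eta10 inv1]]] := stable_inverse uM.
have [C2 [eta2 [C20 eta20 inv2]]] := stable_inverse uMT.
pose eta := Order.min eta1 eta2.
have eta0 : 0 < eta by rewrite lt_min eta10.
have [d1 d10 hd1] : exists2 d, 0 < d & forall ij : 'I_(n + N) * 'I_n,
    forall z, nearby d z z0 -> `|D ij.1 ij.2 z - D ij.1 ij.2 z0| <= eta.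
  apply: common_radius => [ij d d' dd' hd z hz|[i j]].
    by apply: hd => k; apply: le_trans (hz k) dd'.
  have [d d0 hd] := uniform_continuity z0 1
    (fun z => Ck_cont (Ck_deriv i (g_C1 j)) (I : setT z)) eta0.
  exists d => // z hz /=; rewrite distrC; apply: hd => k.
    by rewrite subrr normr0.
  by rewrite distrC.
pose Bd := \sum_i \sum_j `|D i j z0| + eta.
have Bd0 : 0 <= Bd by rewrite addr_ge0 ?(ltW eta0) // sumr_ge0 // => i _; apply: sumr_ge0.
have hBd i j z : nearby d1 z z0 -> `|D i j z| <= Bd.
  move=> hz; rewrite -(subrK (D i j z0) (D i j z)).
  apply: le_trans (ler_normD _ _) _; rewrite addrC; apply: lerD.
    rewrite (bigD1 i) //= (bigD1 j) //= -addrA lerDl addr_ge0 ?sumr_ge0 //.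
    by move=> k _; apply: sumr_ge0.
  exact: (hd1 (i, j)).
(* Makes [C1 * e1] at most 1/2, so that the remainder can be absorbed. *)
pose e1 := (2 * (C1 + 1))^-1.
have C11 : 0 < C1 + 1 by rewrite ltr_wpDl.
have e10 : 0 < e1 by rewrite invr_gt0 mulr_gt0.
have [d2 d20 hd2] : exists2 d, 0 < d & forall j z z' rho, nearby 1 z' z0 ->
    0 <= rho <= d -> nearby rho z z' -> 
    `|g j z - g j z' - \sum_i D i j z' * (z i 0 - z' i 0)| <= e1 * rho.
  apply: common_radius => [j d d' dd' hd z z' r h1 /andP[r0 rd']|j].
    by apply: hd => //; rewrite r0 (le_trans rd').
  exact: strict_derivative.
(* [d1] controls the derivatives and 1 is the radius of the cube in [hd2]; [d2] is halved since two
   points near [z0] may be [2 * rho] apart. *)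
pose rho := Order.min (Order.min d1 1) (d2 / 2).
have rhod1 : rho <= d1 by rewrite !ge_min lexx.
have rho1 : rho <= 1 by rewrite !ge_min lexx orbT.
have rhod2 : rho <= d2 / 2 by rewrite !ge_min lexx !orbT.
have rho0 : 0 < rho by rewrite !lt_min d10 ltr01 divr_gt0.
pose C3 := 2 * (1 + C1 * ((n + N)%:R * Bd)).
have C30 : 0 <= C3 by rewrite mulr_ge0 // addr_ge0 // !mulr_ge0.
exists (Order.max C2 C3), rho; split=> //; first by rewrite le_max C20.
- move=> z z' r gz gz' hz hz' r0 hq.
  pose om := \big[Order.max/0]_i `|z i 0 - z' i 0|.
  have om0 : 0 <= om by apply: bigmax_ge_id.
  have wom i : `|z i 0 - z' i 0| <= om by apply: le_bigmax.
  suff omC : om <= C3 * r.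
    move=> i; apply: le_trans (wom i) _; apply: le_trans omC _.
    by rewrite ler_wpM2r // le_max lexx orbT.
  have omd2 : 0 <= om <= d2.
    rewrite om0; apply/bigmax_leP; split=> [|i _]; first exact: ltW.
    have -> : z i 0 - z' i 0 = (z i 0 - z0 i 0) - (z' i 0 - z0 i 0) by ring.
    apply: le_trans (ler_normB _ _) _.
    have := hz i; have := hz' i; lra.
  have hM : forall i j, `|partial_f z' i j - partial_f z0 i j| <= eta1.
    move=> i j; rewrite !mxE; apply: le_trans (_ : eta <= _); last first.
      by rewrite ge_min lexx.
    apply: (hd1 (_, _)) => k; exact: le_trans (hz' k) _.
  have hw k : `|z (rshift n (f k)) 0 - z' (rshift n (f k)) 0| <=
      C1 * (e1 * om + (n + N)%:R * Bd * r).
    have := inv1 _ hM (\row_k (z (rshift n (f k)) 0 - z' (rshift n (f k)) 0))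
      (e1 * om + (n + N)%:R * Bd * r) _ k.
    rewrite mxE; apply => j.
    have h1 : nearby 1 z' z0 by move=> i; apply: le_trans (hz' i) _.
    have := hd2 j z z' om h1 omd2 wom.
    have hinj : injective (fun k => rshift n (f k)).
      by move=> a b /rshift_inj /f_inj.
    rewrite gz gz' subrr sub0r normrN (sum_codom _ hinj) => hsum.
    rewrite mxE (eq_bigr (fun k => D (rshift n (f k)) j z' *
      (z (rshift n (f k)) 0 - z' (rshift n (f k)) 0))); last first.
      by move=> l _; rewrite !mxE mulrC.
    rewrite -[X in `|X|](addrK (\sum_(i | i \notin codom (fun k => rshift n (f k)))
       D i j z' * (z i 0 - z' i 0))).
    apply: le_trans (ler_normB _ _) _; apply: lerD => //.
    apply: le_trans (ler_norm_sum _ _ _) _.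
    apply: le_trans (_ : \sum_(i | i \notin codom (fun k => rshift n (f k))) Bd * r <= _).
      apply: ler_sum => i hi; rewrite normrM ler_pM //.
        by apply: hBd => l; apply: le_trans (hz' l) _.
      exact: traded_nearby hq _ hi.
    rewrite sumr_const -[leLHS]mulr_natl -mulrA ler_wpM2r ?mulr_ge0 // ler_nat.
    by rewrite -[leqRHS]card_ord max_card.
  suff : om <= r + C1 * (e1 * om + (n + N)%:R * Bd * r).
    have -> : r + C1 * (e1 * om + (n + N)%:R * Bd * r) =
      C3 * r / 2 + om / 2 * (C1 / (C1 + 1)).
      by rewrite /C3 /e1; field; rewrite gt_eqF.
    have q1 : C1 / (C1 + 1) <= 1 by rewrite ler_pdivrMr // mul1r lerDl.
    have : om / 2 * (C1 / (C1 + 1)) <= om / 2 * 1 by rewrite ler_wpM2l // divr_ge0.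
    by move: (om / 2 * _) (C3 * r) => y x; lra.
  have X0 : 0 <= C1 * (e1 * om + (n + N)%:R * Bd * r).
    by rewrite mulr_ge0 // addr_ge0 // !mulr_ge0 // ltW.
  apply/bigmax_leP; split=> [|i _]; first by rewrite addr_ge0.
  case: (boolP (i \in codom (fun k => rshift n (f k)))) => [/codomP[k ->]|hi].
    by apply: le_trans (hw k) _; rewrite lerDr.
  by apply: le_trans (traded_nearby hq hi) _; rewrite lerDl.
- move=> z hz w s hw k.
  have hM : forall i j, `|(partial_f z)^T i j - (partial_f z0)^T i j| <= eta2.
    move=> i j; rewrite !mxE; apply: le_trans (_ : eta <= _); last first.
      by rewrite ge_min lexx orbT.
    apply: (hd1 (_, _)) => l; exact: le_trans (hz l) _.
  apply: le_trans (inv2 _ hM w s hw k) _.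
  by rewrite ler_wpM2r ?le_max ?lexx //; apply: le_trans (hw k).
Qed.

End Localization.
(** By the submersion clause the matrix of the parameter derivatives has rank [n]; [n] independent
    rows of it give [f]. *)
Lemma degenerate_zero_rank (z : 'cV[R]_(n + N)) : degenerate_zero z ->
  exists2 f : 'I_n -> 'I_N, injective f & partial_f f z \in unitmx.
Proof.
move=> [_ _ hz].
have rf : row_full (\matrix_(i, j) D (rshift n i) j z : 'M[R]_(N, n)).
  apply/row_fullP.
  have /choice[eta heta] (l : 'I_n) : exists eta : 'cV[R]_N, forall j,
      'D_(col_mx 0 eta) (g j) z = (l == j)%:R by apply: (hz (fun j => (l == j)%:R)).
  exists (\matrix_(l, i) eta l i 0); apply/matrixP => l j.
  rewrite !mxE -heta derive_basis // big_split_ord /= [X in _ = X + _]big1 ?add0r => [|i _].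
    by apply: eq_bigr => i _; rewrite col_mxEd !mxE mulrC.
  by rewrite col_mxEu mxE mulr0.
exists (fullrankfun rf); first exact: fullrankfun_inj.
rewrite (_ : partial_f _ z = rowsub (fullrankfun rf) (\matrix_(i, j) D (rshift n i) j z)).
  exact: fullrowsub_unit.
by apply/matrixP => k j; rewrite !mxE.
Qed.

(** [w] combines the equations into one that is stationary in the variables and so, to first order,
    restricts the parameters alone. *)
Lemma degenerate_zero_kernel (z : 'cV[R]_(n + N)) : degenerate_zero z ->
  exists2 w : 'rV[R]_n, w != 0 & forall i, \sum_j w 0 j * D (lshift N i) j z = 0.
Proof.
move=> [_ + _]; set J := (X in X \notin _); rewrite -row_free_unit -kermx_eq0.
move=> /rowV0Pn[w /sub_kermxP wJ w0]; exists w => // i.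
have := congr1 (fun A : 'rV[R]_n => A 0 i) wJ; rewrite mxE [in RHS]mxE => H; rewrite -[RHS]H.
by apply: eq_bigr => j _; rewrite mxE.
Qed.

(** For nearby zeros [z], [z'] the equations combined by the kernel vector [w] of [z'] have a linear
    part that involves only the differences of the parameters. These therefore lie in a thin slab
    whose normal is the parameter derivative of the combination, and [null_slabs] applies with the
    traded coordinates as [q]. *)
Lemma null_degenerate_zero : lebesgue_null [set dsubmx z | z in degenerate_zero].
Proof.
apply: null_local => // z0 bad0.
have [f finj uM] := degenerate_zero_rank bad0.
have [C [rho [C0 rho0 lip inv]]] := zeros_lipschitz finj uM.
exists rho => //.
pose S q p := exists z, [/\ degenerate_zero z, nearby rho z z0, q = traded f z & p = dsubmx z].
apply: (@null_subset _ _ _ [set p | exists q, S q p]).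
  by move=> _ [z [bz hz] <-]; exists (traded f z), z.
apply: (@null_slabs R N N_gt0 S (traded f z0) rho C) => //.
- move=> q p [z [_ hz -> _]] i; rewrite !mxE; case: pickP => // k _; exact: hz.
- move=> q p q' p' r [z [[gz _ _] hz -> ->]] [z' [[gz' _ _] hz' -> ->]] r0 hq i.
  by rewrite !mxE; apply: (lip z z' r).
move=> e e0.
(* [n%:R * C * C] collects the number of equations, the bound [C * s] on [w] and the distance
   [C * r] of the zeros. *)
pose e2 := e / (n%:R * C * C + 1).
have K0 : 0 < n%:R * C * C + 1 by rewrite ltr_wpDl // !mulr_ge0.
have e20 : 0 < e2 by rewrite divr_gt0.
have [d d0 hd] : exists2 d, 0 < d & forall j z z' r, nearby rho z' z0 ->
    0 <= r <= d -> nearby r z z' ->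
    `|g j z - g j z' - \sum_i D i j z' * (z i 0 - z' i 0)| <= e2 * r.
  apply: common_radius => [j d d' dd' hd z z' r h1 /andP[r0 rd']|j].
    by apply: hd => //; rewrite r0 (le_trans rd').
  exact: strict_derivative.
(* Traded coordinates at distance [r] belong to zeros at distance [C * r], which must not exceed
   [d]. *)
exists (d / (C + 1)); first by rewrite divr_gt0 // ltr_wpDl.
move=> q0 p0 [z' [bz' hz' -> ->]].
have [w w0 hw] := degenerate_zero_kernel bz'; have [gz' _ _] := bz'.
pose v0 (i : 'I_N) := \sum_j w 0 j * D (rshift n i) j z'.
have [i0 _ hi0] := @arg_maxP _ _ _ (Ordinal N_gt0) xpredT (fun i => `|v0 i|) isT.
set s := `|v0 i0| in hi0.
(* On the parameters indexed by [f], [v0] is the image of [w] under the transpose of [partial_f]; so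
   its largest entry [s] bounds [w], and [s] is positive since [w] is nonzero. *)
have ws k : `|w 0 k| <= C * s.
  apply: (inv z' hz' w s) => l; apply: le_trans (hi0 (f l) isT).
  by rewrite mxE /v0; under eq_bigr do rewrite !mxE.
have s0 : 0 < s.
  rewrite lt_neqAle normr_ge0 andbT eq_sym; apply: contraNneq w0 => s0.
  apply/eqP/rowP => k; rewrite mxE; apply/eqP; rewrite -normr_le0.
  by have := ws k; rewrite s0 mulr0.
have v00 : v0 i0 != 0 by rewrite -normr_gt0.
exists i0, (\col_i (v0 i / v0 i0)); split.
- by rewrite mxE divff.
- move=> i; rewrite mxE normrM normfV ler_pdivrMr // mul1r; exact: hi0.
move=> q p r [z [[gz _ _] hz -> ->]] /andP[r0 rd] hq.
have hzz' : nearby (C * r) z z' by apply: lip.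
have Cr : 0 <= C * r <= d.
  rewrite mulr_ge0 //=; apply: le_trans (_ : (C + 1) * r <= _).
    by rewrite ler_wpM2r // lerDl.
  by rewrite mulrC -ler_pdivlMr // ltr_wpDl.
have est j : `|\sum_i D i j z' * (z i 0 - z' i 0)| <= e2 * (C * r).
  by have := hd j z z' _ hz' Cr hzz'; rewrite gz gz' subrr sub0r normrN.
have E : \sum_i v0 i * (dsubmx z i 0 - dsubmx z' i 0) =
    \sum_j w 0 j * \sum_i D i j z' * (z i 0 - z' i 0).
  rewrite [RHS](eq_bigr (fun j => \sum_i w 0 j * D i j z' * (z i 0 - z' i 0))).
    rewrite exchange_big big_split_ord /= [X in _ = X + _]big1 ?add0r => [|i _].
      by apply: eq_bigr => i _; rewrite !mxE mulr_suml.
    by rewrite -mulr_suml hw mul0r.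
  by move=> j _; rewrite mulr_sumr; apply: eq_bigr => i _; rewrite mulrA.
rewrite (eq_bigr (fun i => (v0 i0)^-1 * (v0 i * (dsubmx z i 0 - dsubmx z' i 0)))).
  rewrite -mulr_sumr E normrM normfV -/s ler_pdivrMl //.
  apply: le_trans (ler_norm_sum _ _ _) _.
  apply: le_trans (_ : \sum_(j < n) (C * s) * (e2 * (C * r)) <= _).
    by apply: ler_sum => j _; rewrite normrM ler_pM.
  rewrite sumr_const card_ord -[leLHS]mulr_natl.
  have -> : n%:R * (C * s * (e2 * (C * r))) = s * (e2 * (n%:R * C * C)) * r by ring.
  rewrite [leRHS]mulrA ler_wpM2r // ler_wpM2l ?(ltW s0) //.
  by rewrite /e2 mulrAC ler_pdivrMr // ler_wpM2l ?(ltW e0) // lerDl.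
by move=> i _; rewrite [in LHS]mxE mulrAC mulrC.
Qed.

End ParametricTransversality.
End Transversality.

(** * The Jacobian and the gradient of the network *)

Section Network.
Variables (R : realType) (n : nat) (A : arch n) (s : activations R A).
Local Notation d := (width A).
Local Notation L := (depth A).

Lemma wt_default (W : weights R A) j : (L.*2 <= j)%N -> wt W j = 0.
Proof. by rewrite /wt; case: {-}_ / idP => // h; rewrite leqNgt h. Qed.

Lemma bs_default (b : biases R A) j : (L.*2 <= j)%N -> bs b j = 0.
Proof. by rewrite /bs; case: {-}_ / idP => // h; rewrite leqNgt h. Qed.

Lemma Xi_odd k j (i : 'I_(d j)) : Xi k s -> odd j -> (j < L.*2)%N ->
  strictly_monotone (s i) /\ Ck_real k (s i).
Proof.
move=> s_Xi oj jL; have [l jE] : exists l, j = l.*2.+1.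
  by exists j./2; rewrite -[LHS]odd_double_half oj.
by subst j; apply: s_Xi; rewrite -ltn_double; apply: ltn_trans jL.
Qed.

(** At odd indices [layer] is the pre-activation, so the factor [Psi] of index [j] itself is not
    included. *)
Fixpoint jac (W : weights R A) (b : biases R A) (x : 'cV[R]_n) (j : nat) :
    'M[R]_(d j, n) :=
  if j is j'.+1 then wt W j' *m Psi s W b x j' *m jac W b x j'
  else castmx (esym (width_in A), erefl n) 1%:M.

Lemma PsiE W b x j i l : Psi s W b x j i l =
  (if odd j then (s i)^`()%classic (layer s W b x j i 0) else 1) *+ (i == l).
Proof. by rewrite /Psi; case: ifP => _; rewrite !mxE. Qed.

Section Smoothness.
Variables (k M : nat) (xz : 'cV[R]_M -> 'cV[R]_n).
Variables (Wz : 'cV[R]_M -> weights R A) (bz : 'cV[R]_M -> biases R A).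
Hypothesis xz_Ck : forall i, Ck k setT (fun z => xz z i 0).
Hypothesis Wz_Ck : forall j i l, Ck k setT (fun z => Wz z j i l).
Hypothesis bz_Ck : forall j i, Ck k setT (fun z => bz z j i 0).

(** Input, weights and biases all depend on one variable [z], so that these lemmas serve both for
    fixed parameters and jointly in the input and the parameters. *)
Lemma wt_Ck j i l : Ck k setT (fun z => wt (Wz z) j i l).
Proof.
case: (ltnP j L.*2) => jL.
  rewrite [X in Ck _ _ X](_ : _ = fun z => Wz z (Ordinal jL) i l) //.
  by apply/funext => z; rewrite -(wtE (Wz z) (Ordinal jL)).
rewrite [X in Ck _ _ X](_ : _ = fun z => 0); first exact: Ck_cst.
by apply/funext => z; rewrite wt_default // mxE.
Qed.

Lemma bs_Ck j i : Ck k setT (fun z => bs (bz z) j i 0).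
Proof.
case: (ltnP j L.*2) => jL.
  rewrite [X in Ck _ _ X](_ : _ = fun z => bz z (Ordinal jL) i 0) //.
  by apply/funext => z; rewrite -(bsE (bz z) (Ordinal jL)).
rewrite [X in Ck _ _ X](_ : _ = fun z => 0); first exact: Ck_cst.
by apply/funext => z; rewrite bs_default // mxE.
Qed.

Lemma layer_Ck j i : Xi k s -> (j <= L.*2)%N ->
  Ck k setT (fun z => layer s (Wz z) (bz z) (xz z) j i 0).
Proof.
move=> s_Xi; elim: j i => [|j IH] i jL /=.
  rewrite [X in Ck _ _ X](_ : _ = fun z => xz z (cast_ord (width_in A) i) 0) //.
  by apply/funext => z; rewrite castmxE /= esymK cast_ord_id.
rewrite [X in Ck _ _ X](_ : _ = fun z => \sum_l wt (Wz z) j i l *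
   activate s (layer s (Wz z) (bz z) (xz z) j) l 0 + bs (bz z) j i 0); last first.
  by apply/funext => z; rewrite !mxE.
apply: CkD; last exact: bs_Ck.
apply: Ck_sum => l _; apply: CkM; first exact: wt_Ck.
rewrite /activate; case oj: (odd j); last by apply: IH; apply: ltnW.
rewrite [X in Ck _ _ X](_ : _ = fun z => s l (layer s (Wz z) (bz z) (xz z) j l 0)).
  by apply: Ck_comp; [have [] := Xi_odd l s_Xi oj jL | apply: IH; apply: ltnW].
by apply/funext => z; rewrite mxE.
Qed.

Lemma Psi_Ck j i l : Xi k.+1 s -> (j < L.*2)%N ->
  Ck k setT (fun z => Psi s (Wz z) (bz z) (xz z) j i l).
Proof.
move=> s_Xi jL; rewrite [X in Ck _ _ X](_ : _ = fun z =>
  (if odd j then (s i)^`()%classic (layer s (Wz z) (bz z) (xz z) j i 0) else 1)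
  * (i == l)%:R); last by apply/funext => z; rewrite PsiE mulr_natr.
apply: CkM; last exact: Ck_cst.
case oj: (odd j); last exact: Ck_cst.
apply: Ck_comp.
  by apply: Ck_real_derive; have [] := Xi_odd i s_Xi oj jL.
apply: layer_Ck; last exact: ltnW.
by move=> l' i' l'L; have [h1 h2] := s_Xi l' i' l'L; split=> //; apply: Ck_realW.
Qed.

Lemma Zrec_Ck r j i : Xi k.+1 s -> (j + r = L.*2)%N ->
  Ck k setT (fun z => Zrec s (Wz z) (bz z) (xz z) r j 0 i).
Proof.
move=> s_Xi; elim: r j i => [|r IH] j i jr /=.
  rewrite [X in Ck _ _ X](_ : _ = fun=> 1); first exact: Ck_cst.
  by apply/funext => z; rewrite mxE.
rewrite [X in Ck _ _ X](_ : _ = fun z => \sum_l (\sum_m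
  Zrec s (Wz z) (bz z) (xz z) r j.+1 0 m *
  Psi s (Wz z) (bz z) (xz z) j.+1 m l) * wt (Wz z) j l i); last first.
  by apply/funext => z; rewrite mxE; apply: eq_bigr => l _; rewrite mxE.
apply: Ck_sum => l _; apply: CkM; last exact: wt_Ck.
apply: Ck_sum => m _; apply: CkM; first by apply: IH; rewrite addSnnS.
case: (ltnP j.+1 L.*2) => jL; first exact: Psi_Ck.
(* The output layer is outside the range of [Psi_Ck], but its index is even and [Psi] is the
   identity there. *)
have oj : odd j.+1 = false.
  have -> : j.+1 = L.*2 by apply/eqP; rewrite eqn_leq jL -jr addnS ltnS leq_addr.
  by rewrite odd_double.
rewrite [X in Ck _ _ X](_ : _ = fun=> (m == l)%:R); first exact: Ck_cst.
by apply/funext => z; rewrite PsiE oj.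
Qed.

Lemma jac_Ck j i l : Xi k.+1 s -> (j <= L.*2)%N ->
  Ck k setT (fun z => jac (Wz z) (bz z) (xz z) j i l).
Proof.
move=> s_Xi; elim: j i => [|j IH] i jL /=; first exact: Ck_cst.
rewrite [X in Ck _ _ X](_ : _ = fun z => \sum_p (\sum_q wt (Wz z) j i q *
  Psi s (Wz z) (bz z) (xz z) j q p) * jac (Wz z) (bz z) (xz z) j p l); last first.
  by apply/funext => z; rewrite mxE; apply: eq_bigr => p _; rewrite mxE.
apply: Ck_sum => p _; apply: CkM; last by apply: IH; apply: ltnW.
by apply: Ck_sum => q _; apply: CkM; [apply: wt_Ck | apply: Psi_Ck].
Qed.

End Smoothness.

Section Gradient.
Variables (W : weights R A) (b : biases R A).

Lemma mlp_Ck k X : Xi k s -> Ck k X (mlp s W b).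
Proof.
move=> s_Xi; apply: (@Ck_subset _ _ _ _ setT) => //.
apply: (@layer_Ck k n id (fun=> W) (fun=> b)) => //.
- exact: Ck_coord.
- by move=> *; apply: Ck_cst.
- by move=> *; apply: Ck_cst.
Qed.

Lemma is_derive_layer (x v : 'cV[R]_n) j i : Xi 1 s -> (j <= L.*2)%N ->
  is_derive x v (fun x => layer s W b x j i 0) ((jac W b x j *m v) i 0).
Proof.
move=> s_Xi; elim: j i => [|j IH] i jL.
  rewrite [X in is_derive _ _ X _](_ : _ = fun z : 'cV[R]_n => z (cast_ord (width_in A) i) 0); last first.
    by apply/funext => z; rewrite /= castmxE /= esymK cast_ord_id.
  rewrite (_ : (jac _ _ _ _ *m v) i 0 = v (cast_ord (width_in A) i) 0).
    exact: is_derive_coord.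
  rewrite mxE (bigD1 (cast_ord (width_in A) i)) //= big1 ?addr0 => [|l li].
    by rewrite castmxE mxE /= esymK cast_ord_id eqxx mul1r.
  by rewrite castmxE mxE /= esymK cast_ord_id eq_sym (negbTE li) mul0r.
have IHj l := IH l (ltnW jL).
have act_derive l : is_derive x v
    (fun x => activate s (layer s W b x j) l 0)
    ((Psi s W b x j *m jac W b x j *m v) l 0).
  rewrite -mulmxA (_ : (Psi _ _ _ _ _ *m _) l 0 =
    (if odd j then (s l)^`()%classic (layer s W b x j l 0) else 1) *
    (jac W b x j *m v) l 0); last first.
    rewrite mxE (bigD1 l) //= big1 ?addr0 => [|m ml].
      by rewrite PsiE eqxx.
    by rewrite PsiE eq_sym (negbTE ml) mul0r.
  rewrite /activate; case oj: (odd j); last by rewrite mul1r; apply: IHj.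
  rewrite [X in is_derive _ _ X _](_ : _ = s l \o (fun x => layer s W b x j l 0)); last first.
    by apply/funext => z; rewrite /= mxE.
  have [dl El] := IHj l.
  rewrite -El; apply: is_derive_comp => //.
  by have [_ [/(_ 0%N _ isT)]] := Xi_odd l s_Xi oj jL.
rewrite [X in is_derive _ _ X _](_ : _ = (\sum_l (fun x => wt W j i l *: activate s (layer s W b x j) l 0)) + cst (bs b j i 0)); last first.
  by apply/funext => z; rewrite /= !mxE fctE /= fct_sumE.
rewrite (_ : (_ *m v) i 0 =
  \sum_l wt W j i l *: (Psi s W b x j *m jac W b x j *m v) l 0 + 0).
  apply: is_deriveD; apply: is_derive_sum => l; exact: is_deriveZ.
by rewrite addr0 /= -!mulmxA mxE.
Qed.

Lemma Psi_even x j : ~~ odd j -> Psi s W b x j = 1%:M.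
Proof. by rewrite /Psi => /negbTE->. Qed.

(** The product does not depend on [j]: by [ZE] and the recursion of [jac] only its bracketing
    changes. The induction starts at the output layer, where [Z] and [Psi] are the 1 x 1
    identity. *)
Lemma derive_mlp x v j : Xi 1 s -> (j <= L.*2)%N ->
  'D_v (mlp s W b) x = (Z s W b x j *m Psi s W b x j *m jac W b x j *m v) 0 0.
Proof.
move=> s_Xi jL; have [r jr] : exists r, (j + r = L.*2)%N.
  by exists (L.*2 - j)%N; rewrite subnKC.
elim: r j {jL} jr => [|r IH] j jr.
  rewrite addn0 in jr; subst j.
  have [_ ->] := is_derive_layer x v (cast_ord (esym (width_out A)) ord0) s_Xi (leqnn _).
  rewrite /Z subnn /= Psi_even ?odd_double // mulmx1 -mulmxA [RHS]mxE.
  rewrite (bigD1 (cast_ord (esym (width_out A)) ord0)) //= big1 ?addr0 => [|l].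
    by rewrite [X in _ = X * _]mxE mul1r.
  case/eqP; apply/val_inj => /=; have := ltn_ord l; rewrite {2}(width_out A).
  by case: (val l).
rewrite (IH j.+1) ?addSnnS // [in RHS]ZE; last by lia.
by rewrite /= !mulmxA.
Qed.

Lemma gradientE x j : Xi 1 s -> (j <= L.*2)%N ->
  gradient (mlp s W b) x = (Z s W b x j *m Psi s W b x j *m jac W b x j)^T.
Proof.
move=> s_Xi jL; apply/matrixP => i k.
by rewrite mxE [RHS]mxE (ord1 k) (derive_mlp _ _ s_Xi jL) -colE mxE.
Qed.

End Gradient.
End Network.

(** * Matrices of deficient rank *)

Section RankDeficiency.
Variable R : realType.

Lemma derive_affine (V : normedModType R) (f : V -> R) (z v : V) (c : R) :
  (forall t, f (t *: v + z) = f z + t * c) -> 'D_v f z = c.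
Proof.
move=> hf; apply: cvg_lim => //; apply: cvg_near_cst; near=> t.
rewrite /= hf addrC addKr -[_ *: _]/(_ * _) mulKf //.
by near: t; apply: nbhs_dnbhs_neq.
Unshelve. all: by end_near. Qed.

Lemma row_free_kernel (a b : nat) (V : 'M[R]_(a, b)) : ~~ row_free V ->
  exists2 w : 'rV[R]_a, w != 0 & w *m V = 0.
Proof.
by rewrite -kermx_eq0 => /rowV0Pn[w /sub_kermxP wV w0]; exists w.
Qed.

(* The relation w V = 0, normalised by w_r = 1, is b equations in the entries
   of V, with w padded to length b by coordinates that do not occur.  The
   derivative in w is singular because w_r does not occur either. *)
Lemma null_row_dependent (a b N : nat) (V : 'cV[R]_N -> 'M[R]_(a, b)) :
  (0 < N)%N -> (a <= b)%N ->
  (forall i j, exists l, forall p, V p i j = p l 0) ->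
  (forall Y, exists p, V p = Y) ->
  lebesgue_null [set p | ~~ row_free (V p)].
Proof.
move=> N_gt0 ab V_coord V_surj.
pose g (r : 'I_a) (j : 'I_b) (z : 'cV[R]_(b + N)) := V (dsubmx z) r j +
  \sum_(q | q != r) usubmx z (widen_ord ab q) 0 * V (dsubmx z) q j.
have V_Ck i j : Ck 1 setT (fun z : 'cV[R]_(b + N) => V (dsubmx z) i j).
  have [l hl] := V_coord i j.
  rewrite [X in Ck _ _ X](_ : _ = fun z : 'cV[R]_(b + N) => z (rshift b l) 0).
    exact: Ck_coord.
  by apply/funext => z; rewrite hl mxE.
have g_Ck r j : Ck 1 setT (g r j).
  apply: CkD => //; apply: Ck_sum => q _; apply: CkM => //.
  rewrite [X in Ck _ _ X](_ : _ = fun z : 'cV[R]_(b + N) =>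
    z (lshift N (widen_ord ab q)) 0); first exact: Ck_coord.
  by apply/funext => z; rewrite mxE.
(* [V] is linear, each entry being a coordinate. *)
have VD p p' (t : R) : V (t *: p + p') = t *: V p + V p'.
  by apply/matrixP => i j; have [l hl] := V_coord i j; rewrite !mxE !hl !mxE.
apply: (@null_subset _ _ _ (\bigcup_r [set dsubmx z | z in degenerate_zero (g r)])); last first.
  by apply: null_countable_union => // r; apply: null_degenerate_zero.
move=> p /row_free_kernel[w w0 wV].
have [r wr] : exists r, w 0 r != 0.
  apply/existsP; apply: contraNT w0 => /existsPn h; apply/eqP/rowP => i.
  by rewrite mxE; apply/eqP; rewrite -[_ == _]negbK h.
exists r => //; pose x : 'cV[R]_b := \col_i
  if insub (val i) is Some q then w 0 q / w 0 r else 0.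
have xE q : x (widen_ord ab q) 0 = w 0 q / w 0 r.
  by rewrite mxE insubT //= => h; congr (w _ _ / _); apply: val_inj.
exists (col_mx x p); last by rewrite col_mxKd.
split.
- move=> j; rewrite /g col_mxKd col_mxKu.
  have := congr1 (fun A : 'rV_b => (w 0 r)^-1 * A 0 j) wV.
  rewrite mxE [X in _ = _ * X]mxE mulr0 => H; rewrite -[RHS]H mulr_sumr [RHS](bigD1 r) //=; congr (_ + _).
    by rewrite mulrA mulVf // mul1r.
  by apply: eq_bigr => q _; rewrite xE mulrA [_^-1 * _]mulrC.
- apply/negP => uD.
  have /matrixP/(_ (widen_ord ab r) 0) : (delta_mx (widen_ord ab r) 0 : 'cV[R]_b) = 0.
    rewrite -[LHS](mulKmx uD) -colE; apply/matrixP => i k.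
    rewrite mxE big1 ?mxE // => j _; rewrite !mxE (derive_affine (c := 0)) ?mulr0 // => t.
    rewrite mulr0 addr0 /g linearD /= linearZ /= (_ : dsubmx (basis_vec _ _) = 0); last first.
      by apply/matrixP => l m; rewrite !mxE eq_rlshift.
    rewrite scaler0 add0r; congr (_ + _); apply: eq_bigr => q qr; congr (_ * _).
    rewrite !mxE eqxx andbT eq_shift (_ : _ == _ = false) ?mulr0 ?add0r //.
    by rewrite -val_eqE /= val_eqE (negbTE qr).
  by rewrite !mxE !eqxx => /eqP; rewrite oner_eq0.
(* Only row [r] of [V] is moved. It enters [g r j] as a separate summand with coefficient 1, so the
   derivative is the prescribed [y]. *)
- move=> y; have [eta heta] := V_surj (\matrix_(i, j) if i == r then y j else 0).
  exists eta => j; apply: derive_affine => t; rewrite /g !linearD /= !linearZ /=.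
  rewrite !col_mxKu !col_mxKd scaler0 add0r VD heta.
  rewrite !mxE eqxx addrAC [RHS]addrC -addrA; congr (_ + _).
  rewrite addrC; congr (_ + _); apply: eq_bigr => q qr.
  by rewrite !mxE (negbTE qr) mulr0 add0r.
Qed.

End RankDeficiency.

(** * The parameter space *)

Section ParameterSpace.
Variables (R : realType) (n : nat) (A : arch n).
Local Notation d := (width A).
Local Notation L := (depth A).

Definition weights_of (p : 'cV[R]_(NW A + NB A)) : weights R A :=
  fun j => vec_mx (submxcol (usubmx p : 'cV[R]_(\sum_(i < L.*2) d i.+1 * d i)) j)^T.

Definition biases_of (p : 'cV[R]_(NW A + NB A)) : biases R A :=
  fun j => submxcol (dsubmx p : 'cV[R]_(\sum_(i < L.*2) d i.+1)) j.

Lemma parametersK W b : weights_of (parameters W b) = W /\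
  biases_of (parameters W b) = b.
Proof.
split; apply: functional_extensionality_dep => j.
  by rewrite /weights_of /parameters col_mxKu mxcolK trmxK mxvecK.
by rewrite /biases_of /parameters col_mxKd mxcolK.
Qed.

Lemma weights_of_coord j i l : exists m, forall p, weights_of p j i l = p m 0.
Proof.
by eexists => p; rewrite /weights_of /submxcol !mxE; reflexivity.
Qed.

Lemma biases_of_coord j i : exists m, forall p, biases_of p j i 0 = p m 0.
Proof.
by eexists => p; rewrite /biases_of /submxcol !mxE; reflexivity.
Qed.

Lemma parameters_gt0 : (0 < NW A + NB A)%N.
Proof.
have L0 : (0 < L.*2)%N by rewrite double_gt0 depth_gt0.
rewrite addn_gt0; apply/orP; right; rewrite /NB (bigD1 (Ordinal L0)) //=.
by rewrite addn_gt0 width_gt0.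
Qed.

(** Each matrix is treated separately; where it has more rows than columns, full rank means that the
    transpose is row free. *)
Lemma null_not_full_rank :
  lebesgue_null [set p | ~ full_rank (weights_of p)].
Proof.
apply: (@null_subset _ _ _ (\bigcup_(j : 'I_L.*2)
  [set p | \rank (weights_of p j) != minn (d j.+1) (d j)])).
  move=> p /= /existsNP[j hj]; exists j => //=; exact/eqP.
apply: null_countable_union => [|j]; first exact: parameters_gt0.
have surj (Y : 'M[R]_(d j.+1, d j)) : exists p, weights_of p j = Y.
  exists (parameters (eqtype.dfwith (T := fun j : 'I_L.*2 => 'M[R]_(d j.+1, d j))
    (fun=> 0) Y) (fun=> 0)).
  by rewrite (parametersK _ _).1 eqtype.dfwith_in.
case: (leqP (d j.+1) (d j)) => dj.
  apply: (@null_row_dependent R (d j.+1) (d j) _ (fun p => weights_of p j)) => //.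
    exact: parameters_gt0.
  exact: weights_of_coord.
apply: (@null_subset _ _ _ [set p | ~~ row_free (weights_of p j)^T]).
  by move=> p /=; rewrite /row_free mxrank_tr.
apply: (@null_row_dependent R (d j) (d j.+1) _ (fun p => (weights_of p j)^T)).
- exact: parameters_gt0.
- exact: ltnW.
- by move=> i l; have [m hm] := @weights_of_coord j l i; exists m => p; rewrite mxE.
- by move=> Y; have [p hp] := surj Y^T; exists p; rewrite hp trmxK.
Qed.

End ParameterSpace.

(** * Perturbations that fix all layers at a point *)

Section Perturbation.
Variables (R : realType) (n : nat) (A : arch n) (s : activations R A).
Local Notation d := (width A).
Local Notation L := (depth A).

Lemma wt_ne W W' (m : 'I_L.*2) (j : nat) : (forall i : 'I_L.*2, i != m -> W i = W' i) ->
  j != m :> nat -> wt W j = wt W' j :> 'M[R]_(d j.+1, d j).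
Proof.
move=> h jm; case: (ltnP j L.*2) => jL; last by rewrite !wt_default.
by rewrite (wtE W (Ordinal jL)) (wtE W' (Ordinal jL)) h.
Qed.

Lemma bs_ne b b' (m : 'I_L.*2) (j : nat) : (forall i : 'I_L.*2, i != m -> b i = b' i) ->
  j != m :> nat -> bs b j = bs b' j :> 'cV[R]_(d j.+1).
Proof.
move=> h jm; case: (ltnP j L.*2) => jL; last by rewrite !bs_default.
by rewrite (bsE b (Ordinal jL)) (bsE b' (Ordinal jL)) h.
Qed.

Section Fixed.
Variables (x : 'cV[R]_n) (m : 'I_L.*2) (W W' : weights R A) (b b' : biases R A).
Hypothesis W_ne : forall i, i != m -> W' i = W i.
Hypothesis b_ne : forall i, i != m -> b' i = b i.
Hypothesis at_m : W' m *m activate s (layer s W b x m) + b' m =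
  W m *m activate s (layer s W b x m) + b m.

(** The altered weights and bias act at [x] only through the sum in [at_m]; all other affine maps
    are unchanged. *)
Lemma layer_fixed j : layer s W' b' x j = layer s W b x j.
Proof.
elim: j => //= j ->; have [jm|jm] := eqVneq j m.
  by subst j; rewrite !wtE !bsE.
by rewrite (wt_ne W_ne jm) (bs_ne b_ne jm).
Qed.

Lemma Psi_fixed j : Psi s W' b' x j = Psi s W b x j.
Proof. by rewrite /Psi layer_fixed. Qed.

(** Up to layer [m], [jac] uses matrices of index below [m]; beyond layer [m], [Z] uses matrices of
    index above [m]. Neither contains the altered matrix. *)
Lemma jac_fixed j : (j <= m)%N -> jac s W' b' x j = jac s W b x j.
Proof.
elim: j => //= j IH jm; rewrite IH ?Psi_fixed ?(ltnW jm) //.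
by rewrite (wt_ne W_ne) // ltn_eqF.
Qed.

Lemma Z_fixed j : (m < j)%N -> Z s W' b' x j = Z s W b x j.
Proof.
rewrite /Z; move: (_ - _)%N => r; elim: r j => //= r IH j jm.
by rewrite IH ?Psi_fixed ?(wt_ne W_ne) ?gtn_eqF // ltnW.
Qed.

End Fixed.

Lemma wt_rank W j : full_rank W -> (j < L.*2)%N ->
  \rank (wt W j : 'M[R]_(d j.+1, d j)) = minn (d j.+1) (d j).
Proof. by move=> hW jL; rewrite (wtE W (Ordinal jL)); apply: (hW (Ordinal jL)). Qed.

Lemma Psi_unit W b x j : Xi 1 s -> (j < L.*2)%N -> Psi s W b x j \in unitmx.
Proof.
move=> s_Xi jL; rewrite /Psi; case: ifPn => oj; last exact: unitmx1.
rewrite unitmxE unitfE det_diag prodf_seq_neq0; apply/allP => i _ /=.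
rewrite mxE; have [[h|h] _] := Xi_odd i s_Xi oj jL; first by rewrite gt_eqF.
by rewrite lt_eqF.
Qed.

Lemma jac_row_free W b x j : Xi 1 s -> full_rank W -> (j <= L.*2)%N ->
  (forall i, (i < j)%N -> (d i.+1 <= d i)%N) -> row_free (jac s W b x j).
Proof.
move=> s_Xi hW; elim: j => [|j IH] jL dec /=.
  by rewrite row_free_castmx row_free_unit unitmx1.
rewrite /row_free !mxrankMfree ?row_free_unit ?Psi_unit //; last first.
  by apply: IH => [|i ij]; [apply: ltnW | apply: dec; apply: ltnW].
by rewrite wt_rank // (minn_idPl (dec j _)).
Qed.

Lemma row_fullM (m p q : nat) (B : 'M[R]_(m, p)) (C : 'M[R]_(p, q)) :
  row_full B -> row_full C -> row_full (B *m C).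
Proof. by move=> hB hC; rewrite /row_full (eqmxMfull C hB). Qed.

(** [row_full] is full column rank: along increasing widths every factor is injective, hence so is
    the product. *)
Lemma jac_row_full W b x j : Xi 1 s -> full_rank W -> (j <= L.*2)%N ->
  (forall i, (i < j)%N -> (d i <= d i.+1)%N) -> row_full (jac s W b x j).
Proof.
move=> s_Xi hW; elim: j => [|j IH] jL dec /=.
  by case: _ / (esym (width_in A)); rewrite castmx_id row_full_unit unitmx1.
apply: row_fullM; last by apply: IH => [|i ij]; [apply: ltnW | apply: dec; apply: ltnW].
apply: row_fullM; last by rewrite row_full_unit Psi_unit.
by rewrite /row_full wt_rank // (minn_idPr (dec j _)).
Qed.

(* The perturbation W_m + t D, b_m - t D u, with u the value of layer m at x,
   fixes all layers at x, so that the gradient at x is affine in t. *)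
Lemma gradient_perturbation W b x (m : 'I_L.*2) (D : 'M[R]_(d m.+1, d m)) :
  Xi 1 s -> exists W' b', forall t : R,
  gradient (mlp s (fun j => W j + t *: W' j) (fun j => b j + t *: b' j)) x =
  gradient (mlp s W b) x + t *:
    (Z s W b x m.+1 *m Psi s W b x m.+1 *m D *m (Psi s W b x m *m jac s W b x m))^T.
Proof.
move=> s_Xi; set u := activate s (layer s W b x m).
pose W' : weights R A := eqtype.dfwith (T := fun j : 'I_L.*2 => 'M[R]_(d j.+1, d j))
  (fun=> 0) D.
pose b' : biases R A := eqtype.dfwith (T := fun j : 'I_L.*2 => 'cV[R]_(d j.+1))
  (fun=> 0) (- (D *m u)).
exists W', b' => t.
have W_ne i : i != m -> W i + t *: W' i = W i.
  by move=> im; rewrite /W' eqtype.dfwith_out 1?eq_sym // scaler0 addr0.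
have b_ne i : i != m -> b i + t *: b' i = b i.
  by move=> im; rewrite /b' eqtype.dfwith_out 1?eq_sym // scaler0 addr0.
have at_m : (W m + t *: W' m) *m u + (b m + t *: b' m) = W m *m u + b m.
  rewrite /W' /b' !eqtype.dfwith_in mulmxDl -scalemxAl scalerN.
  by rewrite addrACA subrr addr0.
(* Taken at layer [m.+1], the product contains the altered matrix once, as the leading factor of
   [jac]. *)
rewrite !(@gradientE _ _ _ _ _ _ _ m.+1) //; try exact: ltn_ord.
rewrite (Z_fixed W_ne b_ne at_m) // (Psi_fixed W_ne b_ne at_m) /=.
rewrite (Psi_fixed W_ne b_ne at_m) (jac_fixed W_ne b_ne at_m) // !wtE.
rewrite /W' eqtype.dfwith_in -[in RHS]linearZ -[in RHS]linearD /=; congr (_ ^T).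
by rewrite !mulmxDl mulmxDr -!scalemxAl -scalemxAr !mulmxA.
Qed.

End Perturbation.

Lemma derive_col_mx (R : realType) (n N : nat) (F : 'cV[R]_(n + N) -> R)
    (x v : 'cV[R]_n) (p : 'cV[R]_N) :
  'D_(col_mx v 0) F (col_mx x p) = 'D_v (fun x => F (col_mx x p)) x.
Proof.
rewrite /derive (_ : (fun h : R => _) = (fun h : R =>
  h^-1 *: (((fun x => F (col_mx x p)) \o shift x) (h *: v) - F (col_mx x p)))) //.
apply/funext => h /=; congr (_ *: (F _ - _)).
by rewrite scale_col_mx add_col_mx scaler0 add0r.
Qed.

Lemma basis_vec_lshift (R : realType) (n N : nat) (i : 'I_n) :
  basis_vec R (lshift N i) = col_mx (basis_vec R i) 0.
Proof.
apply/matrixP => l k; rewrite (ord1 k) mxE eqxx andbT.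
case: (split_ordP l) => m ->; rewrite ?col_mxEu ?col_mxEd !mxE ?eqxx ?andbT.
  by rewrite eq_lshift.
by rewrite eq_rlshift.
Qed.

(** * Critical points and the joint gradient in input and parameters *)

Section CriticalPoints.
Variables (R : realType) (n : nat) (A : arch n) (s : activations R A).
Local Notation d := (width A).
Local Notation L := (depth A).

Lemma Xi_le j k : (j <= k)%N -> Xi k s -> Xi j s.
Proof.
elim: k => [|k IH]; first by rewrite leqn0 => /eqP->.
rewrite leq_eqVlt => /predU1P[->//|/IH{}IH] h; apply: IH => l i lL.
by have [h1 h2] := h l i lL; split=> //; apply: Ck_realW.
Qed.

Lemma critical_Z0 W b x j : Xi 1 s -> (j <= L.*2)%N -> Z s W b x j = 0 ->
  critical (mlp s W b) x.
Proof. by move=> s_Xi jL Z0; rewrite /critical (gradientE _ _ _ s_Xi jL) Z0 !mul0mx trmx0. Qed.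

(** The factors [Psi] and [jac] to the right of [Z] have independent rows and can be cancelled. *)
Lemma noncritical W b x j : Xi 1 s -> full_rank W -> (j < L.*2)%N ->
  (forall i, (i < j)%N -> (d i.+1 <= d i)%N) -> Z s W b x j <> 0 ->
  ~ critical (mlp s W b) x.
Proof.
move=> s_Xi hW jL dec Zn0 /eqP; rewrite (gradientE _ _ _ s_Xi (ltnW jL)) trmx_eq0.
rewrite mulmx_free_eq0 ?jac_row_free // ?(ltnW jL) //.
by rewrite mulmx_free_eq0 ?row_free_unit ?Psi_unit // => /eqP.
Qed.

(* Where Z_j vanishes, the Hessian is (Psi_j jac_j)^T times the derivative of
   Z_j, hence factors through R^(d j). *)
Lemma degenerate_Z0 W b x j : Xi 2 s -> (j < L.*2)%N -> (d j < n)%N ->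
  Z s W b x j = 0 -> degenerate (mlp s W b) x.
Proof.
move=> s_Xi jL dn Z0; have s_Xi1 : Xi 1 s by apply: Xi_le s_Xi.
have W_Ck i l m : Ck 1 setT (fun z : 'cV[R]_n => (fun=> W) z i l m) by apply: Ck_cst.
have b_Ck i l : Ck 1 setT (fun z : 'cV[R]_n => (fun=> b) z i l 0) by apply: Ck_cst.
have x_Ck i : Ck 1 setT (fun z : 'cV[R]_n => id z i 0) by apply: Ck_coord.
pose F l (z : 'cV[R]_n) := Z s W b z j 0 l.
pose H (z : 'cV[R]_n) := Psi s W b z j *m jac s W b z j.
have F_Ck l : Ck 1 setT (F l).
  by apply: (Zrec_Ck x_Ck W_Ck b_Ck) => //; rewrite subnKC // ltnW.
have H_Ck l i : Ck 1 setT (fun z => H z l i).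
  rewrite [X in Ck _ _ X](_ : _ = fun z => \sum_m Psi s W b z j l m * jac s W b z j m i).
    apply: Ck_sum => m _; apply: CkM.
      exact: (Psi_Ck x_Ck W_Ck b_Ck).
    by apply: (jac_Ck x_Ck W_Ck b_Ck) => //; apply: ltnW.
  by apply/funext => z; rewrite mxE.
have DE i : 'D_(basis_vec R i) (mlp s W b) = \sum_l (F l * (fun z => H z l i)).
  apply/funext => z; rewrite (derive_mlp _ _ _ _ s_Xi1 (ltnW jL)) -colE mxE.
  by rewrite fct_sumE -mulmxA mxE.
have HE : hessian (mlp s W b) x =
    (H x)^T *m \matrix_(l, m) 'D_(basis_vec R m) (F l) x.
  apply/matrixP => i m; rewrite !mxE DE derive_sum => [|l].
    apply: eq_bigr => l _; rewrite deriveM; first last.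
    - exact: (Ck_derivable (H_Ck l i) I).
    - exact: (Ck_derivable (F_Ck l) I).
    have -> : F l x = 0 by rewrite /F Z0 mxE.
    by rewrite scale0r add0r [in RHS]mxE [X in _ = _ * X]mxE.
  apply: derivableM; first exact: (Ck_derivable (F_Ck l) I).
  exact: (Ck_derivable (H_Ck l i) I).
rewrite /degenerate HE -row_free_unit /row_free; apply/eqP => rk.
by have := mulmx_max_rank (H x)^T (\matrix_(l, m) 'D_(basis_vec R m) (F l) x);
  rewrite rk leqNgt dn.
Qed.

Definition joint_gradient (j : 'I_n) (z : 'cV[R]_(n + (NW A + NB A))) : R :=
  gradient (mlp s (weights_of (dsubmx z)) (biases_of (dsubmx z))) (usubmx z) j 0.

Lemma joint_gradient_Ck j : Xi 2 s -> Ck 1 setT (joint_gradient j).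
Proof.
move=> s_Xi; have s_Xi1 : Xi 1 s by apply: Xi_le s_Xi.
have L0 : (0 < L.*2)%N by rewrite double_gt0 depth_gt0.
pose xz (z : 'cV[R]_(n + (NW A + NB A))) := usubmx z.
pose Wz (z : 'cV[R]_(n + (NW A + NB A))) := weights_of (dsubmx z).
pose bz (z : 'cV[R]_(n + (NW A + NB A))) := biases_of (dsubmx z).
have x_Ck i : Ck 1 setT (fun z => xz z i 0).
  rewrite [X in Ck _ _ X](_ : _ = fun z : 'cV[R]_(n + (NW A + NB A)) => z (lshift _ i) 0).
    exact: Ck_coord.
  by apply/funext => z; rewrite /xz mxE.
have W_Ck i l m : Ck 1 setT (fun z => Wz z i l m).
  have [q hq] := weights_of_coord R l m.
  rewrite [X in Ck _ _ X](_ : _ = fun z : 'cV[R]_(n + (NW A + NB A)) => z (rshift _ q) 0).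
    exact: Ck_coord.
  by apply/funext => z; rewrite /Wz hq mxE.
have b_Ck i l : Ck 1 setT (fun z => bz z i l 0).
  have [q hq] := biases_of_coord R l.
  rewrite [X in Ck _ _ X](_ : _ = fun z : 'cV[R]_(n + (NW A + NB A)) => z (rshift _ q) 0).
    exact: Ck_coord.
  by apply/funext => z; rewrite /bz hq mxE.
(* In this form only first derivatives of the activations occur, so activations of class C^2 give a
   gradient of class C^1 in all variables. *)
rewrite [X in Ck _ _ X](_ : _ = fun z => \sum_l (\sum_m
   Z s (Wz z) (bz z) (xz z) 0 0 m * Psi s (Wz z) (bz z) (xz z) 0 m l) *
   jac s (Wz z) (bz z) (xz z) 0 l j).
  apply: Ck_sum => l _; apply: CkM; last exact: jac_Ck.
  apply: Ck_sum => m _; apply: CkM; last exact: Psi_Ck.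
  by apply: Zrec_Ck => //; rewrite subn0.
apply/funext => z; rewrite /joint_gradient (gradientE _ _ _ s_Xi1 (leq0n _)) mxE [LHS]mxE.
by apply: eq_bigr => l _; rewrite [in LHS]mxE.
Qed.

(** The matrix from layer [m] to layer [m.+1] is perturbed: as [Z] behind it is nonzero and the
    Jacobian before it is injective, every change of the gradient is attainable. *)
Lemma degenerate_zero_gradient W b x (m : nat) : Xi 2 s -> full_rank W -> (m.+1 < L.*2)%N ->
  (forall i, (i < m)%N -> (d i <= d i.+1)%N) -> Z s W b x m.+1 <> 0 ->
  critical (mlp s W b) x -> degenerate (mlp s W b) x ->
  degenerate_zero joint_gradient (col_mx x (parameters W b)).
Proof.
move=> s_Xi hW mL inc Zn0 crit deg; have s_Xi1 : Xi 1 s by apply: Xi_le s_Xi.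
have [WK bK] := parametersK W b.
split.
- by move=> j; rewrite /joint_gradient col_mxKu col_mxKd WK bK crit mxE.
- rewrite (_ : (\matrix_(_, _) _) = hessian (mlp s W b) x) //.
  apply/matrixP => j i; rewrite !mxE basis_vec_lshift derive_col_mx.
  congr ('D_ _ _ _); apply/funext => x'.
  by rewrite /joint_gradient col_mxKu col_mxKd WK bK mxE.
- move=> y; have mL2 : (m < L.*2)%N by apply: ltnW.
  pose ZP := Z s W b x m.+1 *m Psi s W b x m.+1.
  have ZP0 : ZP != 0.
    by rewrite mulmx_free_eq0 ?row_free_unit ?Psi_unit //; apply/eqP.
  have [r Zr] : exists r, ZP 0 r != 0.
    apply/existsP; apply: contraNT ZP0 => /existsPn h; apply/eqP/rowP => i.
    by rewrite [RHS]mxE; apply/eqP; rewrite -[_ == _]negbK h.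
  have full : row_full (Psi s W b x m *m jac s W b x m).
    apply: row_fullM; first by rewrite row_full_unit Psi_unit.
    by apply: jac_row_full => //; apply: ltnW.
  have [B BG] := row_fullP full.
  (* A matrix of rank at most one: its column factor picks a nonzero entry of [ZP], and the left
     inverse [B] makes its row factor produce [y]. *)
  pose D : 'M[R]_(d m.+1, d m) := delta_mx r 0 *m ((ZP 0 r)^-1 *: ((\row_j y j) *m B)).
  have HD : ZP *m D *m (Psi s W b x m *m jac s W b x m) = \row_j y j.
    rewrite /D -[_ *m _ *m (Psi _ _ _ _ _ *m _)]mulmxA -[delta_mx _ _ *m _ *m _]mulmxA.
    rewrite -scalemxAl -[X in _ *: X]mulmxA BG mulmx1 mulmxA -colE.
    by apply/rowP => j; rewrite mxE big_ord1 [X in X * _]mxE [X in _ * X]mxE mulVKf.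
  have [W' [b' hpert]] := @gradient_perturbation R n A s W b x (Ordinal mL2) D s_Xi1.
  exists (parameters W' b') => j; apply: derive_affine => t.
  have E1 : weights_of (t *: parameters W' b' + parameters W b) =
      fun j => W j + t *: W' j.
    apply: functional_extensionality_dep => l; apply/matrixP => a c.
    have [q hq] := weights_of_coord R a c.
    rewrite hq 2!mxE -(hq (parameters W' b')) -(hq (parameters W b)) WK.
    by rewrite (parametersK W' b').1 !mxE addrC.
  have E2 : biases_of (t *: parameters W' b' + parameters W b) =
      fun j => b j + t *: b' j.
    apply: functional_extensionality_dep => l; apply/matrixP => a c; rewrite (ord1 c).
    have [q hq] := biases_of_coord R a.
    rewrite hq 2!mxE -(hq (parameters W' b')) -(hq (parameters W b)) bK.
    by rewrite (parametersK W' b').2 !mxE addrC.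
  rewrite /joint_gradient !linearD /= !linearZ /= !col_mxKu !col_mxKd scaler0 add0r.
  rewrite E1 E2 WK bK hpert mxE; congr (_ + _); rewrite mxE; congr (_ * _).
  by rewrite [LHS]mxE HD mxE.
Qed.
End CriticalPoints.

(** * A network with a prescribed Hessian *)

Section Realization.
Variable R : realType.

Lemma Ck_realS k (h : R -> R) : (forall y, derivable h y 1) ->
  Ck_real k (h^`()%classic) -> Ck_real k.+1 h.
Proof.
move=> dh [d c]; split=> [[|i] y ik|]; rewrite ?derive1Sn //; exact: d.
Qed.

Lemma Ck_real_cst k (c : R) : Ck_real k (cst c).
Proof.
elim: k c => [|k IH] c; first by split=> // y; apply: cst_continuous.
apply: Ck_realS => [y|]; first exact: derivable_cst.
rewrite (_ : _^`()%classic = cst 0) //.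
by apply/funext => y; rewrite derive1_cst.
Qed.

Lemma derive1_idfun : ((@idfun R)^`()%classic) = cst 1.
Proof. by apply/funext => y; rewrite derive1_id. Qed.

Lemma Ck_real_id k : Ck_real k (@idfun R).
Proof.
case: k => [|k]; first by split=> // y.
apply: Ck_realS => [y|]; first exact: derivable_id.
by rewrite derive1_idfun; apply: Ck_real_cst.
Qed.

Lemma derive1_expR : (@expR R)^`()%classic = expR.
Proof. by apply/funext => y; rewrite derive1E; have [_] := is_derive_expR y. Qed.

Lemma Ck_real_expR k : Ck_real k (@expR R).
Proof.
elim: k => [|k IH]; first by split=> // y; apply: continuous_expR.
by apply: Ck_realS; rewrite ?derive1_expR // => y; apply: derivable_expR.
Qed.

Lemma hessian_separable n (phi : R -> R) (c : 'cV[R]_n) : Ck_real 2 phi ->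
  hessian (fun x : 'cV[R]_n => \sum_k phi (x k 0 - c k 0)) c =
  (phi^`()%classic^`()%classic 0)%:M.
Proof.
move=> phi2.
have D (h : R -> R) i k (x : 'cV[R]_n) : Ck_real 1 h ->
    is_derive x (basis_vec R i) (fun x : 'cV[R]_n => h (x k 0 - c k 0))
      (h^`()%classic (x k 0 - c k 0) *+ (k == i)).
  move=> h1.
  have [dc Dc] : is_derive x (basis_vec R i) (fun x : 'cV[R]_n => x k 0 - c k 0)
      ((k == i)%:R - 0).
    have -> : (k == i)%:R = basis_vec R i k 0 by rewrite mxE eqxx andbT.
    apply: (@is_deriveB _ _ _ _ (cst (c k 0))); exact: is_derive_coord.
  rewrite -mulr_natr -[_%:R]subr0 -Dc.
  apply: (@is_derive_comp R _ (fun x : 'cV[R]_n => x k 0 - c k 0)) => //.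
  by have [/(_ 0%N _ isT)] := h1.
have Dsum (i : 'I_n) : 'D_(basis_vec R i) (fun x : 'cV[R]_n => \sum_k phi (x k 0 - c k 0)) =
    fun x => phi^`()%classic (x i 0 - c i 0).
  apply/funext => x.
  rewrite (_ : (fun x : 'cV[R]_n => _) = \sum_k (fun x : 'cV[R]_n => phi (x k 0 - c k 0))).
    rewrite derive_sum => [|k]; last by have [] := D phi i k x (Ck_realW phi2).
    rewrite (bigD1 i) //= big1 ?addr0 => [|k ki].
      by have [_ ->] := D phi i i x (Ck_realW phi2); rewrite eqxx.
    by have [_ ->] := D phi i k x (Ck_realW phi2); rewrite (negbTE ki).
  by apply/funext => z; rewrite fct_sumE.
apply/matrixP => i j; rewrite !mxE Dsum.
by have [_ ->] := D _ j i c (Ck_real_derive phi2); rewrite subrr.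
Qed.

Section Construction.
Variables (n : nat) (n_gt0 : (0 < n)%N) (tau : R -> R) (c : 'cV[R]_n).
Hypothesis tau_mono : strictly_monotone tau.
Hypothesis tau_Ck : forall k, Ck_real k tau.
Hypothesis tau1 : tau^`()%classic 0 = 1.

(** The bottleneck is layer 2. Layers 1 and 2 carry [x], in layer 1 preceded by a zero. Layer 3
    consists of the sum of the entries of [x - c], left linear, and of [x - c], activated by [tau].
    The output is the sum of [tau (x_k - c_k) - (x_k - c_k)]; by [tau1] it is critical at [c], with
    Hessian the second derivative of [tau] at 0 times the identity. *)
Definition ex_width (j : nat) : nat :=
  match j with 0 => n | 1 => 1 + n | 2 => n | 3 => 1 + n | _ => 1 end%N.

Lemma ex_width_gt0 j : (j <= 2.*2)%N -> (0 < ex_width j)%N.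
Proof. by case: j => [|[|[|[|j]]]]. Qed.

Definition ex_arch : arch n := @Arch n 2 ex_width isT ex_width_gt0 erefl erefl.

Definition ex_act : activations R ex_arch :=
  fun j i => if (j == 3) && (0 < i)%N then tau else idfun.

Definition ex_weight (j : nat) : 'M[R]_(ex_width j.+1, ex_width j) :=
  match j with
  | 0 => col_mx 0 1%:M
  | 1 => row_mx 0 1%:M
  | 2 => col_mx (const_mx 1) 1%:M
  | 3 => row_mx (const_mx (- 1)) (const_mx 1)
  | _ => 0
  end.

Definition ex_bias (j : nat) : 'cV[R]_(ex_width j.+1) :=
  match j with
  | 2 => - (col_mx (const_mx 1) 1%:M *m c)
  | _ => 0
  end.

Definition ex_W : weights R ex_arch := fun j => ex_weight j.
Definition ex_b : biases R ex_arch := fun j => ex_bias j.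

Lemma ex_Xi k : Xi k ex_act.
Proof.
move=> l i lL; rewrite /ex_act; case: ifP => _; first by [].
split; last exact: Ck_real_id.
by left=> y; rewrite derive1_idfun.
Qed.

Lemma ex_bottleneck : first_bottleneck ex_arch 2.
Proof.
split; first by exists 1%N, 3%N; split.
move=> [|[|j]] // _ [i [l [ij jl lL h1 h2]]] //.
by case: i ij h1 => //= _; rewrite ltnNge leqnSn.
Qed.

Lemma ex_increasing : increasing_to ex_arch 1.
Proof. by split=> // -[|l] //= _; apply: leqnSn. Qed.

Lemma ex_wt j : (j < 4)%N -> wt ex_W j = ex_weight j.
Proof. by move=> jL; rewrite (wtE ex_W (Ordinal (jL : (j < (depth ex_arch).*2)%N))). Qed.

Lemma ex_bs j : (j < 4)%N -> bs ex_b j = ex_bias j.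
Proof. by move=> jL; rewrite (bsE ex_b (Ordinal (jL : (j < (depth ex_arch).*2)%N))). Qed.

Lemma ex_layer3 x : layer ex_act ex_W ex_b x 3 = ex_weight 2 *m (x - c).
Proof.
rewrite /= !ex_wt // !ex_bs //= !addr0 castmx_id mulmxBr /activate /=.
rewrite [X in row_mx _ _ *m X](_ : _ = col_mx 0 1%:M *m x); last first.
  by apply/matrixP => i j; rewrite mxE (ord1 j).
rewrite [row_mx _ _ *m _]mulmxA [X in X *m x](_ : _ = 1%:M) ?mul1mx //.
by apply: etrans (mul_row_col 0 1%:M 0 1%:M) _; rewrite mul0mx add0r mulmx1.
Qed.

Lemma ex_mlp :
  mlp ex_act ex_W ex_b = fun x => \sum_k (tau (x k 0 - c k 0) - (x k 0 - c k 0)).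
Proof.
apply/funext => x; rewrite /mlp.
rewrite -[layer _ _ _ _ _]/(wt ex_W 3 *m activate ex_act (layer ex_act ex_W ex_b x 3) + bs ex_b 3).
rewrite ex_layer3 ex_wt // ex_bs //= addr0 mul_col_mx mul1mx /activate /=.
rewrite [X in row_mx _ _ *m X](_ : _ =
  col_mx (const_mx 1 *m (x - c)) (\col_k tau (x k 0 - c k 0))); last first.
  apply/matrixP => i j; rewrite (ord1 j) mxE /ex_act /=.
  case: (split_ordP (i : 'I_(1 + n))) => k ->; rewrite ?col_mxEu ?col_mxEd.
    by rewrite (ord1 k).
  by rewrite !mxE.
rewrite mul_row_col !mxE big_ord1 !mxE mulN1r addrC sumrB; congr (_ - _).
  by apply: eq_bigr => k _; rewrite !mxE mul1r.
by apply: eq_bigr => k _; rewrite !mxE mul1r.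
Qed.

(** At [c] all pre-activations of layer 3 vanish, so [Psi] is the identity there by [tau1], and the
    product of the last two weight matrices is zero. *)
Lemma ex_Z1 : Z ex_act ex_W ex_b c 1 = 0.
Proof.
have P2 : Psi ex_act ex_W ex_b c 2 = 1%:M by [].
have P4 : Psi ex_act ex_W ex_b c 4 = 1%:M by [].
have P3 : Psi ex_act ex_W ex_b c 3 = 1%:M.
  apply/matrixP => i j; rewrite PsiE ex_layer3 subrr mulmx0 !mxE /=; congr (_ *+ _).
  by rewrite /ex_act /=; case: ifP => _; rewrite ?tau1 ?derive1_idfun.
rewrite ZE // ZE // ZE // P2 P3 P4 !mulmx1 !ex_wt //= -!mulmxA.
rewrite [X in _ *m X](_ : _ = 0) ?mulmx0 // mulmxA mul_row_col mulmx1.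
rewrite [X in X *m _](_ : _ = 0) ?mul0mx //.
by apply/matrixP => i j; rewrite !mxE big_ord1 !mxE mulr1 addNr.
Qed.

Lemma ex_hessian : hessian (mlp ex_act ex_W ex_b) c = (tau^`()%classic^`()%classic 0)%:M.
Proof.
have dtau y : derivable tau y 1 by have [/(_ 0%N y isT)] := tau_Ck 1.
have dtau' y : derivable (tau^`()%classic) y 1.
  by have [/(_ 0%N y isT)] := Ck_real_derive (tau_Ck 2).
pose phi t := tau t - t.
have phi1 : phi^`()%classic = fun t => tau^`()%classic t - 1.
  apply/funext => y; rewrite !derive1E (@deriveB _ _ _ tau idfun) //.
  by rewrite -!derive1E derive1_idfun.
have phi2 : phi^`()%classic^`()%classic = tau^`()%classic^`()%classic.
  apply/funext => y; rewrite phi1 !derive1E (@deriveB _ _ _ (tau^`()%classic) (cst 1)) //.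
  by rewrite derive_cst subr0.
rewrite ex_mlp -phi2; apply: (@hessian_separable n phi c).
apply: Ck_realS => [y|].
  by apply: derivableB.
apply: Ck_realS => [y|].
  by rewrite phi1; apply: derivableB.
by rewrite phi2; apply: Ck_real_derive; apply: Ck_real_derive.
Qed.

End Construction.

Lemma example_realized n k (X : set 'cV[R]_n) (tau : R -> R) : (0 < n)%N ->
  X !=set0 -> strictly_monotone tau -> (forall k, Ck_real k tau) ->
  tau^`()%classic 0 = 1 ->
  exists (A' : arch n) (s' : activations R A') (j i : nat)
    (W : weights R A') (b : biases R A') (x : 'cV[R]_n),
  [/\ Xi k s', first_bottleneck A' j, (i < j)%N /\ increasing_to A' i,
      X x /\ Z s' W b x i = 0 &
      critical (mlp s' W b) x /\
      hessian (mlp s' W b) x = (tau^`()%classic^`()%classic 0)%:M].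
Proof.
move=> n0 [c Xc] tau_mono tau_Ck tau1.
exists (ex_arch n0), (@ex_act n n0 tau), 2%N, 1%N, (@ex_W n n0), (@ex_b n n0 c), c.
have Xi_ex l : Xi l (@ex_act n n0 tau) by apply: ex_Xi.
split=> //; first exact: ex_bottleneck.
- by split=> //; apply: ex_increasing.
- by split=> //; apply: ex_Z1.
split; last exact: ex_hessian.
by apply: (@critical_Z0 _ _ _ _ _ _ _ 1) => //; apply: ex_Z1.
Qed.

End Realization.

(** * Classification of networks with a bottleneck *)

Lemma decreasing_width n (A : arch n) j : decreasing_to A j -> (width A j < n)%N.
Proof.
move=> [j0 dec lt_j]; rewrite -[n in (_ < n)%N](width_in A); apply: leq_trans lt_j _.
have : (j.-1 < j)%N by rewrite prednK.
elim: j.-1 => // i IH ij.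
by apply: leq_trans (dec i (ltnW ij)) _; apply: IH; apply: ltnW.
Qed.

Lemma bottleneck_lt n (A : arch n) j : bottleneck A j -> (j < (depth A).*2)%N.
Proof. by move=> [i [l [_ jl lL _ _]]]; apply: leq_trans lL. Qed.

(** Each exceptional set is chosen before the weights and biases. The last clause realises both
    cases of (d) on every nonempty [X], with widths and activations of its own. *)
Theorem theorem3p25 (R : realType) (n k : nat) (X : set 'cV[R]_n)
    (k_ge2 : (2 <= k)%N) (X_open : open X)
    (A : arch n) (s : activations R A) (s_Xi : Xi k s)
    (jstar : nat) (jstar_first : first_bottleneck A jstar) :
  (* (a) *)
  (decreasing_to A jstar ->
    (forall (W : weights R A) (b : biases R A),
      (forall x, X x -> Z s W b x jstar <> 0) ->
      full_rank W -> classC1 k X (mlp s W b)) /\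
    (exists N : set 'cV[R]_(NW A + NB A), lebesgue_null N /\
      forall (W : weights R A) (b : biases R A), ~ N (parameters W b) ->
      (forall x, X x -> Z s W b x jstar <> 0) -> classC1 k X (mlp s W b))) /\
  (* (b) *)
  (decreasing_to A jstar ->
    forall (W : weights R A) (b : biases R A),
    let Xstar := [set x | X x /\ Z s W b x jstar = 0] in
    Xstar !=set0 ->
    (forall x, Xstar x -> critical (mlp s W b) x /\ degenerate (mlp s W b) x) /\
    classC3 k X (mlp s W b)) /\
  (* (c) *)
  (forall istar : nat, (istar < jstar)%N -> increasing_to A istar ->
    (exists N : set 'cV[R]_(NW A + NB A), lebesgue_null N /\
      forall (W : weights R A) (b : biases R A), ~ N (parameters W b) ->
      full_rank W ->
      (forall x, X x -> Z s W b x istar <> 0) ->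
      classC1 k X (mlp s W b) \/ classC2 k X (mlp s W b)) /\
    (exists N : set 'cV[R]_(NW A + NB A), lebesgue_null N /\
      forall (W : weights R A) (b : biases R A), ~ N (parameters W b) ->
      (forall x, X x -> Z s W b x istar <> 0) ->
      classC1 k X (mlp s W b) \/ classC2 k X (mlp s W b))) /\
  (* (d) *)
  (forall istar : nat, (istar < jstar)%N -> increasing_to A istar ->
    forall (W : weights R A) (b : biases R A),
    let Xstar := [set x | X x /\ Z s W b x istar = 0] in
    Xstar !=set0 ->
    (forall x, Xstar x -> critical (mlp s W b) x) /\
    (classC2 k X (mlp s W b) \/ classC3 k X (mlp s W b))) /\
  (* (d), both cases occur *)
  (X !=set0 ->
    let realized (P : ('cV[R]_n -> R) -> 'cV[R]_n -> Prop) :=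
      exists (A' : arch n) (s' : activations R A') (j i : nat)
             (W : weights R A') (b : biases R A') (x : 'cV[R]_n),
      [/\ Xi k s', first_bottleneck A' j, (i < j)%N /\ increasing_to A' i,
          X x /\ Z s' W b x i = 0 & critical (mlp s' W b) x /\ P (mlp s' W b) x]
    in
    realized (fun f x => degenerate f x) /\
    realized (fun f x => ~ degenerate f x)).
Proof.
have Xi1 : Xi 1 s by apply: Xi_le s_Xi; apply: ltnW.
have Xi2 : Xi 2 s by apply: Xi_le s_Xi.
have smooth W b : Ck k X (mlp s W b) by apply: mlp_Ck.
have jL := bottleneck_lt jstar_first.1.
have n_gt0 : (0 < n)%N by rewrite -(width_in A) width_gt0.
split; [|split; [|split; [|split]]].
- move=> [_ dec _].
  have full W b : (forall x, X x -> Z s W b x jstar <> 0) -> full_rank W ->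
      classC1 k X (mlp s W b).
    by move=> Zn0 hW; split=> // x Xx; apply: (noncritical (j := jstar)) => //; apply: Zn0.
  split=> //; exists [set p | ~ full_rank (weights_of p)].
  split; first exact: null_not_full_rank.
  move=> W b; rewrite /= (parametersK W b).1 => /contrapT hW Zn0; exact: full.
- move=> dec W b Xstar [x0 Xstar0].
  have deg x : Xstar x -> critical (mlp s W b) x /\ degenerate (mlp s W b) x.
    move=> [_ Z0]; split; first exact: (critical_Z0 Xi1 (ltnW jL)).
    exact: (degenerate_Z0 Xi2 jL (decreasing_width dec)).
  split=> //; split=> //; exists x0.
  by have [crit0 deg0] := deg _ Xstar0; split=> //; have [] := Xstar0.
- move=> istar ij [i0 inc _].
  (* One set serves both statements of (c), since it contains the parameters of deficient rank. *)
  pose N := [set p | ~ full_rank (weights_of p)] `|`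
    [set dsubmx z | z in degenerate_zero (joint_gradient s)].
  have N_null : lebesgue_null N.
    apply: (@null_subset _ _ _ (\bigcup_(b : bool) if b then
        [set p : 'cV[R]_(NW A + NB A) | ~ full_rank (weights_of p)] else
        [set dsubmx z | z in degenerate_zero (joint_gradient s)])).
      by move=> p [hp|hp]; [exists true|exists false].
    apply: null_countable_union => [|[]]; first exact: parameters_gt0.
      exact: null_not_full_rank.
    apply: null_degenerate_zero => [|j]; first exact: parameters_gt0.
    exact: joint_gradient_Ck.
  have main W b : ~ N (parameters W b) ->
      (forall x, X x -> Z s W b x istar <> 0) ->
      classC1 k X (mlp s W b) \/ classC2 k X (mlp s W b).
    move=> /not_orP[/=]; rewrite (parametersK W b).1 => /contrapT hW nbad Zn0.
    have [[x [Xx crit]]|none] := pselect (exists x, X x /\ critical (mlp s W b) x).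
      right; split=> //; first by exists x.
      move=> y Xy crity deg; apply: nbad; exists (col_mx y (parameters W b)).
        (* The perturbed matrix is the one entering layer [istar]: the widths increase up to its
           input layer, and [Z] is nonzero at its output layer. *)
        apply: (@degenerate_zero_gradient _ _ _ _ _ _ _ istar.-1) => //.
        + by rewrite prednK // (ltn_trans ij).
        + by move=> i ii; apply: inc; apply: leq_trans ii (leq_pred _).
        + by rewrite prednK //; apply: Zn0.
      by rewrite col_mxKd.
    by left; split=> // x Xx crit; apply: none; exists x.
  split; exists N; split=> // W b hN.
  by move=> _; apply: main.
- move=> istar ij _ W b Xstar [x0 Xstar0].
  have crit x : Xstar x -> critical (mlp s W b) x.
    move=> [_ Z0]; apply: (critical_Z0 Xi1 _ Z0).
    by apply: ltnW; apply: ltn_trans jL.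
  split=> //.
  have [[x [Xx critx degx]]|none] := pselect (exists x,
      [/\ X x, critical (mlp s W b) x & degenerate (mlp s W b) x]).
    by right; split=> //; exists x.
  left; split=> //; first by exists x0; split; [have [] := Xstar0 | apply: crit].
  by move=> x Xx critx degx; apply: none; exists x.
- move=> X0 realized; split.
  (* With the identity as [tau] the Hessian is zero, which is singular because [n > 0]. *)
  + have mono : strictly_monotone (@idfun R) by left=> y; rewrite derive1_idfun.
    have [|A' [s' [j [i [W [b [x [h1 h2 h3 h4 [h5 h6]]]]]]]]] :=
      example_realized k n_gt0 X0 mono (fun l => Ck_real_id R l).
      by rewrite derive1_idfun.
    exists A', s', j, i, W, b, x; split=> //; split=> //.
    rewrite /degenerate h6 derive1_idfun derive1_cst.
    rewrite (_ : 0%:M = 0 :> 'M[R]_n); last by apply/matrixP => u v; rewrite !mxE mul0rn.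
    by rewrite -row_free_unit /row_free mxrank0 eq_sym -lt0n.
  (* The exponential has first and second derivative 1 at 0, so the Hessian is the identity. *)
  + have mono : strictly_monotone (@expR R) by left=> y; rewrite derive1_expR expR_gt0.
    have [|A' [s' [j [i [W [b [x [h1 h2 h3 h4 [h5 h6]]]]]]]]] :=
      example_realized k n_gt0 X0 mono (fun l => Ck_real_expR R l).
      by rewrite derive1_expR expR0.
    exists A', s', j, i, W, b, x; split=> //; split=> //.
    by rewrite /degenerate h6 !derive1_expR expR0 unitmx1.
Qed.
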